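(* Let $G$ be a countable infinite discrete group, $k\ge1$, and let $T$ be the $(C,F)$-action of $G$ associated with a sequence $(C_n,F_{n-1})_{n\ge1}$ satisfying (I)–(III), equipped with a $(C,F)$-measure $\mu$ associated with a sequence $(\lambda_n)_{n\ge0}$, such that for each $g\in G$ and $n>0$, $$\lim_{m\to\infty}\sum_{i=1}^k\#(A_{m,n}^i)\lambda_m^i=\sum_{i=1}^k\#(F_n^i)\lambda_n^i,\qquad A_{m,n}:=(g\cdot F_n*C_{n+1}*\cdots*C_m)\cap F_m.$$ Then $T$ is measure theoretically isomorphic to the $(C,F)$-action $S$ of $G$ (equipped with a $(C,F)$-measure) associated with a sequence $(C'_n,F'_{n-1})_{n\ge1}$ satisfying (I)–(III) and the condition: for each $g\in G$ and $n>0$ there is $m>n$ such that $g\cdot F'_n*C'_{n+1}*\cdots*C'_m\subset F'_m$. Moreover, the sequence $(F'_n)_{n\ge0}$ is a subsequence of $(F_n)_{n\ge0}$. In particular, if $G=\mathbb Z$ and $T$ is of rank at most $k$ then $S$ is also of rank at most $k$.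
   Context: **$(C,F)$-construction of finite funny rank.** Let $G'=G\times\{1,\dots,k\}$, $G''=\{1,\dots,k\}\times G\times\{1,\dots,k\}$. Products are defined when indices match: $(f,i)*(i,g,l)=(fg,l)\in G'$, $(i,c,j)*(j,c',l)=(i,cc',l)\in G''$; $A*C$ is the set of all defined products $a*c$; $g\cdot(f,i)=(gf,i)$. For $A\subset G'$, $A^i=A\cap(G\times\{i\})$; for $C\subset G''$, $C^{i,j}=C\cap(\{i\}\times G\times\{j\})$. Let $F_n\subset G'$ ($n\ge0$), $C_n\subset G''$ ($n\ge1$) be finite with: (I) $F_0=\{1\}\times\{1,\dots,k\}$, $\sum_{j=1}^k\#C_n^{i,j}>1$ and $(1,i)\in F_n$ for each $i$; (II) $F_n*C_{n+1}\subset F_{n+1}$; (III) $F_n*\boldsymbol c\cap F_n*\boldsymbol c'=\emptyset$ for distinct $\boldsymbol c,\boldsymbol c'\in C_{n+1}$. $X_n$ is the set of $(\boldsymbol f_n,\boldsymbol c_{n+1},\dots)\in F_n\times C_{n+1}\times C_{n+2}\times\cdots$ such that $\boldsymbol f_n*\boldsymbol c_{n+1}*\cdots*\boldsymbol c_l$ is defined for each $l>n$; $X_n$ embeds into $X_{n+1}$ via $(\boldsymbol f_n,\boldsymbol c_{n+1},\dots)\mapsto(\boldsymbol f_n*\boldsymbol c_{n+1},\boldsymbol c_{n+2},\dots)$; $X$ is the topological inductive limit. For $A\subset F_n$, $[A]_n=\{(\boldsymbol f_n,\dots)\in X_n:\boldsymbol f_n\in A\}$. Let $r_n=(\#C_n^{i,j})_{1\le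 i,j\le k}$. For vectors $\lambda_n=(\lambda_n^1,\dots,\lambda_n^k)^t\in\mathbb R^k_+$ with $\lambda_n=r_{n+1}\lambda_{n+1}$ ($n\ge0$), the associated $(C,F)$-measure is the Radon measure with $\mu([A]_n)=\sum_i\#(A^i)\lambda_n^i$. The $(C,F)$-action: $T_gx=(g\cdot\boldsymbol f_n,\boldsymbol c_{n+1},\dots)$ for $x=(\boldsymbol f_n,\boldsymbol c_{n+1},\dots)\in X_n$ with $g\cdot\boldsymbol f_n\in F_n$; under the displayed limit condition it is defined $\mu$-a.e. for all $g$ and preserves $\mu$. **Rank at most $k$** (for $\mathbb Z$-actions): there are finite-measure sets $B_n^j$ and sets $F_n^j=\{0,1,\dots,\#F_n^j-1\}$, $1\le j\le k$, $n\ge 0$, such that for each $n$ the sets $T_gB_n^j$ ($g\in F_n^j$, $1\le j\le k$) are pairwise disjoint and $\lim_n\inf_{F^j\subset F_n^j}\mu(B\triangle\bigsqcup_{j}\bigsqcup_{g\in F^j}T_gB_n^j)=0$ for each $B$ of finite measure. *)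

(* Defs.v *)
From HB Require Import structures.
From mathcomp Require Import all_boot all_order all_algebra finmap.
From mathcomp Require Import all_classical all_reals all_analysis.

Set Implicit Arguments.
Unset Strict Implicit.
Unset Printing Implicit Defensive.

Import Order.TTheory GRing.Theory Num.Theory.
Import numFieldNormedType.Exports.

Local Open Scope classical_set_scope.
Local Open Scope ring_scope.
Local Open Scope quotient_scope.

(* Throughout, the number of indices is [k.+1], so that it is at least 1.     *)
(* [Gl] and [Gm] are the sets G' and G''; [(i, g, l) : Gm] parses as          *)
(* [((i, g), l)], hence the projections [c.1.1], [c.1.2] and [c.2].           *)
Definition Gl (G : groupType) (k : nat) : choiceType := (G * 'I_k.+1)%type.
Definition Gm (G : groupType) (k : nat) : choiceType :=
  ('I_k.+1 * G * 'I_k.+1)%type.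

Section Products.
Context {G : groupType} {k : nat}.
Implicit Types (f : Gl G k) (c : Gm G k) (A : {fset Gl G k}).
Implicit Type C : {fset Gm G k}.

Definition composable f c : bool := f.2 == c.1.1.

(* The value of f * c, meaningful only when [composable f c]. *)
Definition star f c : Gl G k := ((f.1 * c.1.2)%g, c.2).

Definition fstar A C : {fset Gl G k} :=
  [fset star f c | f in A, c in [fset c in C | composable f c]]%fset.

Definition translate (g : G) f : Gl G k := ((g * f.1)%g, f.2).

Definition ftranslate (g : G) A : {fset Gl G k} :=
  [fset translate g f | f in A]%fset.

Definition slice A (i : 'I_k.+1) : {fset Gl G k} :=
  [fset f in A | f.2 == i]%fset.

Definition slice2 C (i j : 'I_k.+1) : {fset Gm G k} :=
  [fset c in C | (c.1.1 == i) && (c.2 == j)]%fset.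

(* A * C_{n+1} * ... * C_m, which is A when m <= n. *)
Definition fstars (C : nat -> {fset Gm G k}) A (n m : nat) : {fset Gl G k} :=
  foldl fstar A [seq C j | j <- index_iota n.+1 m.+1].

End Products.

(* Sequences satisfying (I)-(III); the value [CF_C 0] is never used. *)
Record CFseq (G : groupType) (k : nat) := {
  CF_F : nat -> {fset Gl G k};
  CF_C : nat -> {fset Gm G k};
  CF_F0 : CF_F 0 = [fset (1%g, i) | i : 'I_k.+1]%fset;
  CF_C_gt1 : forall n i, (1 < \sum_(j < k.+1) #|` slice2 (CF_C n.+1) i j|)%N;
  CF_F_one : forall n i, (1%g, i) \in CF_F n;
  CF_F_sub : forall n, (fstar (CF_F n) (CF_C n.+1) `<=` CF_F n.+1)%fset;
  CF_F_disj : forall n c c', c \in CF_C n.+1 -> c' \in CF_C n.+1 -> c != c' ->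
    (fstar (CF_F n) [fset c] `&` fstar (CF_F n) [fset c'] = fset0)%fset }.

Section Space.
Context {G : groupType} {k : nat}.

(* Ambient space of all the X_n: [(f, c)] stands for (f, c 0, c 1, ...), with *)
(* the product topology of the discrete topologies. In X_n, the entry [c j]   *)
(* is the component c_{n+1+j}.                                                *)
Definition CF_path : Type :=
  (discrete_topology (Gl G k) *
   prod_topology (fun _ : nat => discrete_topology (Gm G k)))%type.
HB.instance Definition _ := Topological.on CF_path.

(* The product f * c 0 * ... * c (l - 1). *)
Definition pathprod (x : CF_path) (l : nat) : Gl G k :=
  foldl star x.1 [seq x.2 j | j <- iota 0 l].

(* (f, c 0, c 1, ...) |-> (f * c 0, c 1, c 2, ...) *)
Definition path_step (x : CF_path) : CF_path :=
  (star x.1 (x.2 0%N), fun j => x.2 j.+1).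

Definition CF_Xn (T : CFseq G k) (n : nat) : set CF_path :=
  [set x | [/\ x.1 \in CF_F T n,
               forall j, x.2 j \in CF_C T (n + j).+1 &
               forall l, composable (pathprod x l) (x.2 l)]].

(* The disjoint union of the X_n. *)
Definition CF_sum (T : CFseq G k) : topologicalType :=
  {n : nat & set_type (CF_Xn T n)}.

(* [u] in X_n and [v] in X_m are identified when they have the same image     *)
(* under the iterated embeddings into some X_l, l = n + p = m + q.            *)
Definition CF_eqv (T : CFseq G k) : rel (CF_sum T) := fun u v =>
  `[< exists p q, (projT1 u + p = projT1 v + q)%N /\
        iter p path_step (set_val (projT2 u)) =
        iter q path_step (set_val (projT2 v)) >].

Lemma CF_eqv_refl (T : CFseq G k) : reflexive (@CF_eqv T).
Proof. by move=> u; apply/asboolP; exists 0%N, 0%N. Qed.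

Lemma CF_eqv_sym (T : CFseq G k) : symmetric (@CF_eqv T).
Proof.
move=> u v; rewrite /CF_eqv; apply/asbool_equiv_eq.
by split=> -[p [q [e1 e2]]]; exists q, p.
Qed.

Lemma CF_eqv_trans (T : CFseq G k) : transitive (@CF_eqv T).
Proof.
move=> v u w /asboolP[p [q [e1 e2]]] /asboolP[p' [q' [e3 e4]]].
apply/asboolP; exists (p + p')%N, (q' + q)%N; split.
  by rewrite addnA e1 addnAC e3 addnA.
by rewrite addnC iterD e2 -iterD addnC iterD e4 -iterD addnC.
Qed.

Canonical CF_eqv_rel (T : CFseq G k) :=
  EquivRel (@CF_eqv T) (@CF_eqv_refl T) (@CF_eqv_sym T) (@CF_eqv_trans T).

(* The topological inductive limit of the X_n. *)
Definition CF_X (T : CFseq G k) : Type :=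
  quotient_topology {eq_quot (@CF_eqv T)}.
HB.instance Definition _ (T : CFseq G k) := Topological.on (CF_X T).

Definition CF_in (T : CFseq G k) (n : nat) (x : set_type (CF_Xn T n)) : CF_X T :=
  \pi_({eq_quot (@CF_eqv T)}) (existT _ n x : CF_sum T).

(* Measurable types are pointed, so X has to be shown nonempty. *)
Lemma CF_X_inhabited (T : CFseq G k) : exists x : CF_X T, True.
Proof.
have nextP n (i : 'I_k.+1) :
  exists c : Gm G k, (c \in CF_C T n.+1) && (c.1.1 == i).
  apply: contrapT => H; have := CF_C_gt1 T n i; rewrite big1 // => j _.
  apply/eqP; rewrite cardfs_eq0; apply/eqP/fsetP => c; rewrite !inE.
  by apply/negP => /andP[cC /andP[ci _]]; apply: H; exists c; rewrite cC ci.
pose nx n i := xchoose (nextP n i).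
have nxC n i : nx n i \in CF_C T n.+1 by case/andP: (xchooseP (nextP n i)).
have nxi n i : (nx n i).1.1 = i by case/andP: (xchooseP (nextP n i)) => _ /eqP.
pose c := fix c j : Gm G k := if j is j'.+1 then nx j (c j').2 else nx 0%N ord0.
have cC j : c j \in CF_C T j.+1.
  by case: j => [|j]; exact: nxC.
have cc j : composable (pathprod ((1%g, ord0), c) j) (c j).
  rewrite /composable; case: j => [|j]; first by rewrite /= nxi.
  by rewrite /pathprod -[in iota _ _](addn1 j) iotaD map_cat foldl_cat /= nxi.
have x0X : CF_Xn T 0 ((1%g, ord0), c) by split=> //=; exact: CF_F_one.
by exists (CF_in (SigSub (mem_set x0X))).
Qed.

HB.instance Definition _ (T : CFseq G k) :=
  isPointed.Build (CF_X T) (sval (cid (CF_X_inhabited T))).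

(* X with its Borel sigma-algebra. *)
Definition CF_borel (T : CFseq G k) := g_sigma_algebraType (@open (CF_X T)).

Definition CF_cyl (T : CFseq G k) (n : nat) (A : {fset Gl G k}) :
    set (CF_borel T) :=
  [set @CF_in T n x | x in [set x | (set_val x).1 \in A]].

(* Graph of the partially defined map T_g: [CF_action T g x y] is T_g x = y. *)
Definition CF_action (T : CFseq G k) (g : G) (x y : CF_borel T) : Prop :=
  exists n (u v : set_type (CF_Xn T n)),
    [/\ CF_in u = x, CF_in v = y, (set_val v).1 = translate g (set_val u).1 &
        (set_val v).2 = (set_val u).2].

(* r_n *)
Definition CF_mx (R : realType) (T : CFseq G k) (n : nat) : 'M[R]_k.+1 :=
  \matrix_(i, j) #|` slice2 (CF_C T n) i j|%:R.

(* R_+ is the set of positive reals: all the weights are nonzero. *)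
Definition CF_weights (R : realType) (T : CFseq G k)
    (lam : nat -> 'cV[R]_k.+1) : Prop :=
  (forall n i, 0 < lam n i ord0) /\
  (forall n, lam n = CF_mx R T n.+1 *m lam n.+1).

(* sum_i #(A^i) lambda^i *)
Definition weight (R : realType) (lam : 'cV[R]_k.+1) (A : {fset Gl G k}) : R :=
  \sum_(i < k.+1) #|` slice A i|%:R * lam i ord0.

End Space.

Arguments CF_path : clear implicits.

Definition radon (R : realType) (X : ptopologicalType)
    (mu : set (g_sigma_algebraType (@open X)) -> \bar R) : Prop :=
  (forall K : set X, compact K -> (mu K < +oo)%E) /\
  (forall B : set (g_sigma_algebraType (@open X)), measurable B ->
     mu B = ereal_sup [set mu K | K in [set K : set X | compact K /\ K `<=` B]]).

Definition CF_measure (R : realType) (G : groupType) (k : nat) (T : CFseq G k)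
    (lam : nat -> 'cV[R]_k.+1)
    (mu : {measure set (CF_borel T) -> \bar R}) : Prop :=
  radon mu /\
  forall n A, (A `<=` CF_F T n)%fset -> mu (CF_cyl n A) = (weight (lam n) A)%:E.

(* A partially defined action of [G] on [X] is given by the graphs of its     *)
(* transformations: [T g x y] means that T_g x is defined and equal to y.     *)

(* Isomorphism of almost everywhere defined measure preserving actions: an    *)
(* equivariant, bimeasurable, measure preserving bijection between conull     *)
(* sets on which all the transformations are defined and which they preserve. *)
Definition isomorphic (R : realType) (G : Type) d d'
    (X : measurableType d) (Y : measurableType d')
    (mu : {measure set X -> \bar R}) (T : G -> X -> X -> Prop)
    (nu : {measure set Y -> \bar R}) (S : G -> Y -> Y -> Prop) : Prop :=
  exists (X0 : set X) (Y0 : set Y) (phi : X -> Y),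
    [/\ measurable X0 /\ mu (~` X0) = 0%E,
        measurable Y0 /\ nu (~` Y0) = 0%E,
        set_bij X0 Y0 phi,
        measurable_fun X0 phi /\
        (forall A, measurable A -> A `<=` X0 ->
           measurable (phi @` A) /\ nu (phi @` A) = mu A) &
        forall g x, X0 x -> exists x',
          [/\ X0 x', T g x x' & S g (phi x) (phi x')]].

(* The set T_g B for a partially defined T_g. *)
Definition act_image (G X : Type) (T : G -> X -> X -> Prop) (g : G)
    (B : set X) : set X :=
  [set y | exists2 x, B x & T g x y].

(* [h n j] is the cardinality of F_n^j = {0, ..., h n j - 1}. *)
Definition rank_at_most (k : nat) (R : realType) d (X : measurableType d)
    (mu : {measure set X -> \bar R}) (T : int -> X -> X -> Prop) : Prop :=
  exists (B : nat -> 'I_k -> set X) (h : nat -> 'I_k -> nat),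
    [/\ forall n j, measurable (B n j) /\ (mu (B n j) < +oo)%E,
        forall n, trivIset [set p : 'I_k * nat | (p.2 < h n p.1)%N]
          (fun p => act_image T p.2%:Z (B n p.1)) &
        forall D, measurable D -> (mu D < +oo)%E ->
          ereal_inf [set mu (D `+` \bigcup_(j in [set: 'I_k])
                                     \bigcup_(g in E j) act_image T g%:Z (B n j))
                    | E in [set E : 'I_k -> set nat |
                             forall j, E j `<=` `I_(h n j)]]
          @[n --> \oo] --> 0%E].

(* Main.v *)
(* Points are followed through their positions: [x] has position [f] at level
   [n] if it lies in X_n with F_n-coordinate [f]. The positions at infinitely
   many levels determine the point, and the sets of points with a given position
   form a basis of compact open sets.
   Fix an enumeration (g_j) of G. Along a subsequence l_0 = 0 < l_1 < ... keep in
   C_{l_n+1} * ... * C_{l_{n+1}} only the blocks [c] with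
   g_j * F_{l_n} * c contained in F_{l_{n+1}} for all j < l_n. By the limit
   hypothesis, l_{n+1} can be chosen so that the discarded blocks carry mass less
   than any tolerance depending on l_n only. With summable tolerances,
   Borel-Cantelli shows that almost every point has only good blocks from some
   level on; these points are the image of the new space X', which embeds
   continuously in X, and the new measure is the pullback of [mu]. Its weights are
   the masses of the new cylinders; they stay positive since the tolerance at l_n
   is a small fraction of all the weights up to level l_n + 1, and this also
   leaves at least two good blocks over each index. *)
Require Import Defs.
From HB Require Import structures.
From mathcomp Require Import all_boot all_order all_algebra finmap.
From mathcomp Require Import all_classical all_reals all_analysis lra.

Set Implicit Arguments.
Unset Strict Implicit.
Unset Printing Implicit Defensive.

Import Order.TTheory GRing.Theory Num.Theory.
Import numFieldNormedType.Exports.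

Local Open Scope classical_set_scope.
Local Open Scope ring_scope.

(** * Products of blocks *)

Section Combinatorics.
Context {G : groupType} {k : nat}.
Implicit Types (f h : Gl G k) (c : Gm G k) (A : {fset Gl G k}).
Implicit Types (C : nat -> {fset Gm G k}) (T : CFseq G k).

Lemma in_fstarP A (D : {fset Gm G k}) h :
  reflect (exists f c, [/\ f \in A, c \in D, composable f c & h = star f c])
          (h \in fstar A D).
Proof.
apply: (iffP (imfset2P _ _ _ _ _)) => [[f /= fA [c]]|[f [c [fA cD fc ->]]]].
  by rewrite !inE /= => /andP[cD fc] ->; exists f, c.
by exists f => //; exists c => //; rewrite !inE cD.
Qed.

Lemma translate_star g f c : translate g (star f c) = star (translate g f) c.
Proof. by rewrite /translate /star /= mulgA. Qed.

Lemma translateK g : cancel (@translate G k g) (translate g^-1%g).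
Proof. by case=> x i; rewrite /translate /= mulKg. Qed.

Lemma translateKV g : cancel (translate g^-1%g) (@translate G k g).
Proof. by case=> x i; rewrite /translate /= mulVKg. Qed.

Lemma translate_inj g : injective (@translate G k g).
Proof. exact: can_inj (translateK g). Qed.

Lemma in_ftranslate g A h : (h \in ftranslate g A) = (translate g^-1%g h \in A).
Proof.
apply/imfsetP/idP => [[f /= fA ->]|hA]; first by rewrite translateK.
by exists (translate g^-1%g h) => //; rewrite translateKV.
Qed.

Lemma ftranslate_fstar g A (D : {fset Gm G k}) :
  ftranslate g (fstar A D) = fstar (ftranslate g A) D.
Proof.
apply/fsetP => h; rewrite in_ftranslate.
apply/in_fstarP/in_fstarP => -[f [c [fA cD fc e]]].
  exists (translate g f), c; split => //; first by rewrite in_ftranslate translateK.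
  by rewrite -translate_star -e translateKV.
exists (translate g^-1%g f), c; split => //; first by rewrite -in_ftranslate.
by rewrite e translate_star.
Qed.

Lemma fstarSS A A' (D D' : {fset Gm G k}) : (A `<=` A')%fset ->
  (D `<=` D')%fset -> (fstar A D `<=` fstar A' D')%fset.
Proof.
move=> /fsubsetP sA /fsubsetP sD; apply/fsubsetP => h /in_fstarP[f [c [fA cD fc e]]].
by apply/in_fstarP; exists f, c; split; [exact: sA|exact: sD|..].
Qed.

Lemma fstars_id C A n : fstars C A n n = A.
Proof. by rewrite /fstars /index_iota subnn. Qed.

Lemma fstarsS C A n m : (n <= m)%N ->
  fstars C A n m.+1 = fstar (fstars C A n m) (C m.+1).
Proof.
move=> nm; rewrite /fstars /index_iota subSS subSn// -[(m - n).+1]addn1 iotaD.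
by rewrite addSn subnKC// map_cat foldl_cat.
Qed.

Lemma fstars_cat C A n j m : (n <= j)%N -> (j <= m)%N ->
  fstars C A n m = fstars C (fstars C A n j) j m.
Proof.
move=> nj /subnKC <-; elim: (m - j)%N => [|p IH]; first by rewrite addn0 fstars_id.
by rewrite addnS fstarsS ?IH ?fstarsS// ?leq_addr// (leq_trans nj)// leq_addr.
Qed.

Lemma ftranslate_fstars g C A n m : (n <= m)%N ->
  ftranslate g (fstars C A n m) = fstars C (ftranslate g A) n m.
Proof.
move=> /subnKC <-; elim: (m - n)%N => [|p IH]; first by rewrite addn0 !fstars_id.
by rewrite addnS !fstarsS ?leq_addr// ftranslate_fstar IH.
Qed.

Lemma fstarsS_sub C A A' n m : (n <= m)%N -> (A `<=` A')%fset ->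
  (fstars C A n m `<=` fstars C A' n m)%fset.
Proof.
move=> /subnKC <- sA; elim: (m - n)%N => [|p IH]; first by rewrite addn0 !fstars_id.
by rewrite addnS !fstarsS ?leq_addr//; exact: fstarSS.
Qed.

Lemma in_fstarsP C A n m h : (n <= m)%N ->
  reflect (exists2 f, f \in A & h \in fstars C [fset f]%fset n m)
          (h \in fstars C A n m).
Proof.
move=> nm; apply: (iffP idP) => [|[f fA]]; last first.
  by apply: (fsubsetP (fstarsS_sub _ nm _)); rewrite fsub1set.
rewrite -(subnKC nm); elim: (m - n)%N h => [|p IH] h.
  by rewrite addn0 fstars_id => hA; exists h; rewrite // fstars_id !inE.
rewrite addnS fstarsS ?leq_addr// => /in_fstarP[h' [c [/IH[f fA fh'] cC hc ->]]].
exists f => //; rewrite fstarsS ?leq_addr//; apply/in_fstarP.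
by exists h', c.
Qed.

(** Membership of [h] in [fstars C [fset f] n m] is the descent relation used from here on: [h] at
    level [m] arises from [f] at level [n] by appending blocks. This is its transitivity, and
    [fstars1_split] is the interpolation of an intermediate level. *)
Lemma fstars1_trans C n j m f a h : (n <= j)%N -> (j <= m)%N ->
  a \in fstars C [fset f]%fset n j -> h \in fstars C [fset a]%fset j m ->
  h \in fstars C [fset f]%fset n m.
Proof.
move=> nj jm fa ah; rewrite (fstars_cat _ _ nj jm); apply/in_fstarsP => //.
by exists a.
Qed.

Lemma fstars1_split C n j m f h : (n <= j)%N -> (j <= m)%N ->
  h \in fstars C [fset f]%fset n m ->
  exists2 a, a \in fstars C [fset f]%fset n j & h \in fstars C [fset a]%fset j m.
Proof. by move=> nj jm; rewrite (fstars_cat _ _ nj jm) => /(in_fstarsP _ _ _ jm). Qed.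

Lemma fstars1_step C n f c : c \in C n.+1 -> composable f c ->
  star f c \in fstars C [fset f]%fset n n.+1.
Proof.
move=> cC fc; rewrite fstarsS// fstars_id; apply/in_fstarP.
by exists f, c; rewrite !inE.
Qed.

Lemma fstars1_stepP C n f h : h \in fstars C [fset f]%fset n n.+1 ->
  exists c, [/\ c \in C n.+1, composable f c & h = star f c].
Proof.
rewrite fstarsS// fstars_id => /in_fstarP[f' [c [/fset1P -> cC fc ->]]].
by exists c.
Qed.

Lemma fstars_sub T A n m : (n <= m)%N -> (A `<=` CF_F T n)%fset ->
  (fstars (CF_C T) A n m `<=` CF_F T m)%fset.
Proof.
move=> /subnKC <- sA; elim: (m - n)%N => [|p IH]; first by rewrite addn0 fstars_id.
rewrite addnS fstarsS ?leq_addr//; apply: fsubset_trans (CF_F_sub _ _).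
exact: fstarSS.
Qed.

Lemma fstars1_sub T n m f h : (n <= m)%N -> f \in CF_F T n ->
  h \in fstars (CF_C T) [fset f]%fset n m -> h \in CF_F T m.
Proof. by move=> nm fF; apply: fsubsetP; apply: fstars_sub; rewrite ?fsub1set. Qed.

(** Distinct blocks have disjoint copies of F_n by (III), so the blocks agree. Right cancellation
    then gives the group component, and composability gives the index. *)
Lemma CF_star_inj T n f f' c c' : f \in CF_F T n -> f' \in CF_F T n ->
  c \in CF_C T n.+1 -> c' \in CF_C T n.+1 -> composable f c ->
  composable f' c' -> star f c = star f' c' -> f = f' /\ c = c'.
Proof.
move=> fF f'F cC c'C fc f'c' e.
have ecc : c = c'.
  apply: contrapT => /eqP ncc; have /fsetP/(_ (star f c)) := CF_F_disj cC c'C ncc.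
  rewrite !inE => /negP; apply; apply/andP; split; apply/in_fstarP.
    by exists f, c; rewrite !inE.
  by exists f', c'; rewrite !inE.
subst c'; split=> //; case: f f' e fc f'c' {fF f'F} => [x i] [y j] /= [].
by move=> /mulIg -> ; rewrite /composable /= => /eqP -> /eqP ->.
Qed.

(** Ancestors are unique: (III) recovers the last block and the previous position, and induction
    descends to level [n]. *)
Lemma fstars1_inj T n m f f' h : (n <= m)%N -> f \in CF_F T n ->
  f' \in CF_F T n -> h \in fstars (CF_C T) [fset f]%fset n m ->
  h \in fstars (CF_C T) [fset f']%fset n m -> f = f'.
Proof.
move=> /subnKC <- fF f'F; elim: (m - n)%N h => [|p IH] h.
  by rewrite addn0 !fstars_id => /fset1P <- /fset1P.
rewrite addnS !fstarsS ?leq_addr// => /in_fstarP[a [c [fa cC ac ->]]].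
move=> /in_fstarP[b [c' [fb c'C bc' e]]]; apply: (IH a fa).
suff -> : a = b by [].
have aF := fstars1_sub (leq_addr _ _) fF fa.
have bF := fstars1_sub (leq_addr _ _) f'F fb.
by case: (CF_star_inj aF bF cC c'C ac bc' e).
Qed.

Lemma fstars1_translate C n m g f h : (n <= m)%N ->
  (translate g h \in fstars C [fset translate g f]%fset n m) =
  (h \in fstars C [fset f]%fset n m).
Proof.
move=> nm; rewrite -[in RHS](translateK g h) -in_ftranslate ftranslate_fstars//.
congr (_ \in fstars _ _ _ _); apply/fsetP => a; rewrite in_ftranslate !inE.
by rewrite (can2_eq (translateKV g) (translateK g)).
Qed.

Lemma cardfs_gt1P (K : choiceType) (A : {fset K}) :
  reflect (exists x y, [/\ x \in A, y \in A & x != y]) (1 < #|` A|)%N.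
Proof.
apply: (iffP idP) => [A1|[x [y [xA yA xy]]]]; last first.
  have -> : 2%N = #|` [fset x; y]%fset| by rewrite cardfs2 xy.
  by apply: fsubset_leq_card; apply/fsubsetP => z /fset2P[]->.
have /fset0Pn[x xA] : A != fset0 by rewrite -cardfs_gt0 (ltn_trans _ A1).
have /fset0Pn[y] : (A `\ x != fset0)%fset.
  by rewrite -cardfs_gt0 -(ltn_add2l 1) addn0; move: A1; rewrite (cardfsD1 x) xA.
by rewrite !inE => /andP[yx yA]; exists x, y; rewrite eq_sym.
Qed.

Lemma in_slice A (i : 'I_k.+1) f : (f \in slice A i) = (f \in A) && (f.2 == i).
Proof. by rewrite !inE. Qed.

Lemma in_slice2 (D : {fset Gm G k}) (i j : 'I_k.+1) c :
  (c \in slice2 D i j) = [&& c \in D, c.1.1 == i & c.2 == j].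
Proof. by rewrite !inE. Qed.

(** Sorting the blocks that start at [i] by their last index turns the count in (I) into the
    cardinality of one set, from which [CF_next] extracts two distinct blocks. *)
Lemma sum_card_slice2 (D : {fset Gm G k}) (i : 'I_k.+1) :
  (\sum_(j < k.+1) #|` slice2 D i j| = #|` [fset c in D | c.1.1 == i]%fset|)%N.
Proof.
set P := [fset c in D | _]%fset.
rewrite [RHS]cardfE -sum1_card (partition_big (fun x : P => (val x).2) predT)//=.
apply: eq_bigr => j _; rewrite sum1_card.
have inP (c : Gm G k) : c \in slice2 D i j -> c \in P.
  by rewrite !inE => /andP[-> /andP[-> _]].
have -> : slice2 D i j = [fset val x | x : P & (val x).2 == j]%fset.
  apply/fsetP => c; apply/idP/imfsetP => [cs|[x /= + ->]].
    exists [` inP _ cs]%fset => //=; have := cs.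
    by rewrite !inE /= => /andP[_ /andP[_ ->]].
  by have := valP x; rewrite !inE /= => /andP[-> ->].
rewrite card_imfset; last exact: val_inj.
rewrite cardE; apply/perm_size/uniq_perm; rewrite ?enum_uniq ?enum_finmem_uniq//.
by move=> x; rewrite mem_enum enum_finmemE.
Qed.

Lemma CF_next T n (i : 'I_k.+1) : exists c1 c2,
  [/\ c1 \in CF_C T n.+1, c2 \in CF_C T n.+1, c1 != c2, c1.1.1 = i & c2.1.1 = i].
Proof.
have := CF_C_gt1 T n i; rewrite sum_card_slice2 => /cardfs_gt1P.
move=> [c1 [c2 []]]; rewrite !inE => /andP[c1C /eqP c1i] /andP[c2C /eqP c2i] ?.
by exists c1, c2.
Qed.

End Combinatorics.

(** * The path spaces *)

(** The sets [E p] of sequences agreeing with [u] in the first [p] coordinates generate a filter. It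
    converges to [u] coordinate by coordinate, hence in the product topology, so it contains [W]. *)
Lemma nbhs_prod_nat (K : nat -> topologicalType) (u : prod_topology K)
    (W : set (prod_topology K)) :
  nbhs u W -> exists p, forall v, (forall j, (j < p)%N -> v j = u j) -> W v.
Proof.
pose E p := [set v : prod_topology K | forall j, (j < p)%N -> v j = u j].
pose F := filter_from [set: nat] E.
have FF : Filter F.
  apply: filter_from_filter; first by exists 0%N.
  move=> i j _ _; exists (maxn i j) => // v Ev; split=> l lt; apply: Ev;
  by rewrite leq_max lt ?orbT.
have : F --> u.
  apply/cvg_sup => i A [B [[V oV <-] Vu] sBA]; exists i.+1 => // v Ev.
  by apply: sBA; rewrite /= Ev.
by move=> /(_ W) H /H[p _ sEW]; exists p.
Qed.

Section Space.
Context {G : groupType} {k : nat}.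
Implicit Types (f h : Gl G k) (c : Gm G k) (A : {fset Gl G k}).
Implicit Types (u v : CF_path G k).

Lemma nbhs_CF_pathP u (W : set (CF_path G k)) :
  nbhs u W <->
  exists p, forall v, v.1 = u.1 -> (forall j, (j < p)%N -> v.2 j = u.2 j) -> W v.
Proof.
split=> [[[P Q] /= [Pu Qu] sW]|[p H]].
  have [p Hp] := nbhs_prod_nat Qu; exists p => v e1 e2.
  by apply: sW; split => /=; [rewrite e1; exact: nbhs_singleton|exact: Hp].
exists ([set u.1], [set w | forall j, (j < p)%N -> w j = u.2 j]); last first.
  by move=> v [/= e1 e2]; exact: H.
split => /=; first exact: discrete_set1.
elim: p {H} => [|p IH]; first exact: filterS filterT.
have : nbhs u.2 (proj p @^-1` [set u.2 p]).
  by apply: (@proj_continuous _ _ p u.2); exact: discrete_set1.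
move=> /(filterI IH); apply: filterS => w [/= Hw wp] j.
by rewrite ltnS leq_eqVlt => /predU1P[->//|]; exact: Hw.
Qed.

Lemma pathprodS u l : pathprod u l.+1 = star (pathprod u l) (u.2 l).
Proof. by rewrite /pathprod -[in iota _ _](addn1 l) iotaD map_cat foldl_cat. Qed.

Lemma pathprod_step u l : pathprod (path_step u) l = pathprod u l.+1.
Proof. by elim: l => [//|l IH]; rewrite pathprodS IH [RHS]pathprodS. Qed.

Lemma iter_path_step p u :
  iter p path_step u = (pathprod u p, fun j => u.2 (p + j)%N).
Proof.
elim: p => [|p IH]; first by case: u.
rewrite iterS IH /path_step pathprodS /= addn0; congr (_, _).
by apply/funext => j; rewrite addnS.
Qed.

Variable T : CFseq G k.

Lemma CF_Xn_pathprod n u p : CF_Xn T n u ->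
  pathprod u p \in fstars (CF_C T) [fset u.1]%fset n (n + p).
Proof.
move=> [_ uC uc]; elim: p => [|p IH]; first by rewrite addn0 fstars_id inE.
rewrite addnS fstarsS ?leq_addr// pathprodS; apply/in_fstarP.
by exists (pathprod u p), (u.2 p).
Qed.

Lemma CF_Xn_pathprod_F n u p : CF_Xn T n u -> pathprod u p \in CF_F T (n + p).
Proof.
move=> Xu; apply: fstars1_sub (CF_Xn_pathprod p Xu); first exact: leq_addr.
by case: Xu.
Qed.

Lemma CF_Xn_step n u : CF_Xn T n u -> CF_Xn T n.+1 (path_step u).
Proof.
move=> Xu; have [uF uC uc] := Xu; split.
- by have := CF_Xn_pathprod_F 1 Xu; rewrite addn1.
- by move=> j /=; rewrite addSnnS.
- by move=> l; rewrite pathprod_step; exact: uc.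
Qed.

Lemma CF_Xn_iter n u p : CF_Xn T n u -> CF_Xn T (n + p) (iter p path_step u).
Proof.
move=> Xu; elim: p => [|p IH]; first by rewrite addn0.
by rewrite addnS iterS; exact: CF_Xn_step.
Qed.

(** By (III) the product of the head with the first block determines both, so the embedding of X_n
    into X_(n+1) loses nothing. *)
Lemma path_step_inj n u v : CF_Xn T n u -> CF_Xn T n v ->
  path_step u = path_step v -> u = v.
Proof.
move=> [uF uC uc] [vF vC vc] [e1 e2 e3].
have e : star u.1 (u.2 0%N) = star v.1 (v.2 0%N) by rewrite /star e1 e2.
have := uC 0%N; have := vC 0%N; rewrite !addn0 => v0 u0.
have [e4 e5] := CF_star_inj uF vF u0 v0 (uc 0%N) (vc 0%N) e.
case: u v e4 e5 e3 {e e1 e2 uF uC uc vF vC vc u0 v0} => [f a] [f' b] /= -> e5 e3.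
congr (_, _); apply/funext => -[//|j].
exact: (congr1 (fun w => w j) e3).
Qed.

Lemma iter_path_step_inj n u v p : CF_Xn T n u -> CF_Xn T n v ->
  iter p path_step u = iter p path_step v -> u = v.
Proof.
move=> Xu Xv; elim: p => [//|p IH] e; apply: IH.
exact: path_step_inj (CF_Xn_iter p Xu) (CF_Xn_iter p Xv) e.
Qed.

(** Takes the membership proof as an argument, so that points can be built from raw paths; [CF_inE]
    translates from [CF_in]. *)
Definition CF_point n u (Xu : CF_Xn T n u) : CF_X T := CF_in (SigSub (mem_set Xu)).

Lemma CF_pointP (x : CF_X T) : exists n u (Xu : CF_Xn T n u), x = CF_point Xu.
Proof.
rewrite -[x]reprK; case: (repr x) => n [u Xu]; exists n, u, (set_mem Xu).
rewrite /CF_point /CF_in; have -> // : exist _ u Xu = SigSub (mem_set (set_mem Xu)).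
exact: val_inj.
Qed.

Lemma CF_point_eqP n m u v (Xu : CF_Xn T n u) (Xv : CF_Xn T m v) :
  CF_point Xu = CF_point Xv <->
  exists p q, (n + p = m + q)%N /\ iter p path_step u = iter q path_step v.
Proof.
split=> [/eqmodP/asboolP//|H]; apply/eqmodP/asboolP; exact: H.
Qed.

Lemma CF_inE n (a : set_type (CF_Xn T n)) : CF_in a = CF_point (set_valP a).
Proof.
by rewrite /CF_point; congr CF_in; apply: val_inj.
Qed.

(* [x] lies in X_n, with F_n-coordinate [f]. *)
Definition pos n (x : CF_X T) f : Prop :=
  exists u (Xu : CF_Xn T n u), CF_point Xu = x /\ u.1 = f.

End Space.

(** * Positions *)

Section Positions.
Context {G : groupType} {k : nat}.
Implicit Types (f h : Gl G k) (c : Gm G k) (A : {fset Gl G k}).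
Implicit Types (u v : CF_path G k).
Variable T : CFseq G k.
Implicit Types (x y : CF_X T).
Local Notation C := (CF_C T).

Lemma CF_cylE n A x : CF_cyl n A x <-> exists2 f, f \in A & pos n x f.
Proof.
split=> [[a /= aA <-]|[f fA [u [Xu [<- e]]]]].
  by exists (set_val a).1 => //; rewrite CF_inE; exists (set_val a), (set_valP a).
by exists (SigSub (mem_set Xu)) => //=; rewrite e.
Qed.

Lemma CF_cyl1E n f x : CF_cyl n [fset f]%fset x <-> pos n x f.
Proof.
rewrite CF_cylE; split=> [[h /fset1P ->]//|xf]; exists f => //; exact: fset11.
Qed.

Lemma CF_point_iter n u (Xu : CF_Xn T n u) p :
  CF_point Xu = CF_point (CF_Xn_iter p Xu).
Proof. by apply/CF_point_eqP; exists p, 0%N; rewrite addn0. Qed.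

Lemma CF_point_inj n u v (Xu : CF_Xn T n u) (Xv : CF_Xn T n v) :
  CF_point Xu = CF_point Xv -> u = v.
Proof.
move=> /CF_point_eqP[p [q [/addnI -> e]]].
exact: iter_path_step_inj Xu Xv e.
Qed.

Lemma pos_CF_point n u (Xu : CF_Xn T n u) p :
  pos (n + p) (CF_point Xu) (pathprod u p).
Proof.
exists (iter p path_step u), (CF_Xn_iter p Xu); split; first by rewrite -CF_point_iter.
by rewrite iter_path_step.
Qed.

Lemma pos_CF_point0 n u (Xu : CF_Xn T n u) : pos n (CF_point Xu) u.1.
Proof. by exists u, Xu. Qed.

Lemma pos_mem n x f : pos n x f -> f \in CF_F T n.
Proof. by move=> [u [[uF _ _] [_ <-]]]. Qed.

Lemma pos_uniq n x f h : pos n x f -> pos n x h -> f = h.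
Proof.
move=> [u [Xu [<- <-]]] [v [Xv [e <-]]].
by rewrite (CF_point_inj e).
Qed.

Lemma pos_ex x : exists n f, pos n x f.
Proof.
have [n [u [Xu ->]]] := CF_pointP x; exists n, u.1.
by exists u, Xu.
Qed.

Lemma pos_fstars n m x f : (n <= m)%N -> pos n x f ->
  exists2 h, pos m x h & h \in fstars C [fset f]%fset n m.
Proof.
move=> /subnKC <- [u [Xu [<- <-]]]; exists (pathprod u (m - n)).
  exact: pos_CF_point.
exact: CF_Xn_pathprod.
Qed.

Lemma pos_pos_fstars n m x f h : (n <= m)%N -> pos n x f -> pos m x h ->
  h \in fstars C [fset f]%fset n m.
Proof. by move=> nm /(pos_fstars nm)[h' xh' fh'] /(pos_uniq xh') <-. Qed.

(** A right inverse of [path_step] on paths whose head is [star f c]: the head of [u] is replaced by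
    [f] followed by the block [c]. *)
Definition path_cons f c u : CF_path G k :=
  (f, fun j => if j is j'.+1 then u.2 j' else c).

Lemma CF_Xn_cons n f c u : f \in CF_F T n -> c \in C n.+1 -> composable f c ->
  star f c = u.1 -> CF_Xn T n.+1 u ->
  CF_Xn T n (path_cons f c u) /\ path_step (path_cons f c u) = u.
Proof.
move=> fF cC fc e [uF uC uc].
have st : path_step (path_cons f c u) = u.
  by rewrite /path_step /= e; case: (u).
split=> //; split => //; first by case=> [|j] /=; [rewrite addn0|rewrite addnS -addSn].
case=> [//|l]; rewrite -pathprod_step st; exact: uc.
Qed.

(** The blocks that lead from [f] to [h] can be put in front of a path of [x] in X_m, one at a time,
    which gives a path of the same point in X_n. Thus the cylinder at a descendant lies inside the
    cylinder at its ancestor. *)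
Lemma pos_pred n m x f h : (n <= m)%N -> f \in CF_F T n ->
  h \in fstars C [fset f]%fset n m -> pos m x h -> pos n x f.
Proof.
move=> /subnKC <- fF; elim: (m - n)%N h => [|p IH] h.
  by rewrite addn0 fstars_id => /fset1P ->.
rewrite addnS fstarsS ?leq_addr// => /in_fstarP[a [c [fa cC ac ->]]].
move=> [u [Xu [ex e]]]; apply: (IH _ fa).
have aF := fstars1_sub (leq_addr p n) fF fa.
have [Xv st] := CF_Xn_cons aF cC ac (esym e) Xu.
exists (path_cons a c u), Xv; split=> //; rewrite -ex; apply/CF_point_eqP.
by exists 1%N, 0%N; rewrite addn1 addn0.
Qed.

(** A common position at a late level forces common positions at all levels between, by uniqueness
    of ancestors. Consecutive positions then determine the blocks by (III). *)
Lemma pos_ext x y :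
  (forall N, exists2 m, (N <= m)%N & exists f, pos m x f /\ pos m y f) -> x = y.
Proof.
move=> H; have [n _ [f [[u [Xu [xu uf]]] [v [Xv [yv vf]]]]]] := H 0%N.
suff e : u = v by subst v; rewrite -xu -yv; apply/CF_point_eqP; exists 0%N, 0%N.
have eqp p : pathprod u p = pathprod v p.
  have [m le [h [xh yh]]] := H (n + p)%N.
  have xp := pos_CF_point Xu p; have yp := pos_CF_point Xv p.
  rewrite xu in xp; rewrite yv in yp.
  have hF := pos_mem xp; have hF' := pos_mem yp.
  exact: fstars1_inj le hF hF' (pos_pos_fstars le xp xh) (pos_pos_fstars le yp yh).
have eq2 j : u.2 j = v.2 j.
  have [uF uC uc] := Xu; have [vF vC vc] := Xv.
  have := eqp j.+1; rewrite !pathprodS => e.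
  by have [] := CF_star_inj (CF_Xn_pathprod_F j Xu) (CF_Xn_pathprod_F j Xv)
    (uC j) (vC j) (uc j) (vc j) e.
case: u v eq2 uf vf {Xu xu Xv yv eqp} => [a b] [a' b'] /= eq2 -> ->.
by congr (_, _); apply/funext.
Qed.

(** Each step of the chain is multiplication by some block; the chosen blocks form a path starting
    at [a 0], whose partial products are the given positions. *)
Lemma pos_realize n (a : nat -> Gl G k) : a 0%N \in CF_F T n ->
  (forall p, a p.+1 \in fstars C [fset a p]%fset (n + p) (n + p).+1) ->
  exists x, forall p, pos (n + p) x (a p).
Proof.
move=> aF H; have /choice[c cP] p := fstars1_stepP (H p).
pose u : CF_path G k := (a 0%N, c).
have pu p : pathprod u p = a p.
  elim: p => [//|p IH]; rewrite pathprodS IH.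
  by have [_ _ ->] := cP p.
have Xu : CF_Xn T n u.
  by split=> [//|j|l]; [have [] := cP j|rewrite pu; have [] := cP l].
by exists (CF_point Xu) => p; rewrite -pu; exact: pos_CF_point.
Qed.

(* The intermediate positions [a] are the ancestors of the given ones. *)
Lemma pos_realize_sub (l : nat -> nat) n (h : nat -> Gl G k) :
  {homo l : i j / (i < j)%N} -> h n \in CF_F T (l n) ->
  (forall m, (n <= m)%N -> h m.+1 \in fstars C [fset h m]%fset (l m) (l m.+1)) ->
  exists x, forall m, (n <= m)%N -> pos (l m) x (h m).
Proof.
move=> lmono hF H.
have lle i j : (i <= j)%N -> (l i <= l j)%N by exact: (ltnW_homo lmono).
have lge j : (j <= l j)%N.
  by elim: j => [//|j IH]; apply: leq_ltn_trans IH (lmono _ _ _).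
have hh i j : (n <= i)%N -> (i <= j)%N ->
    h j \in fstars C [fset h i]%fset (l i) (l j).
  move=> ni /subnKC <-; elim: (j - i)%N => [|p IH].
    by rewrite addn0 fstars_id inE.
  rewrite addnS; apply: fstars1_trans IH (H _ _); rewrite ?lle ?leq_addr//.
  exact: leq_trans ni (leq_addr _ _).
pose anc j b m := b \in CF_F T j /\ h m \in fstars C [fset b]%fset j (l m).
have ancS j b m m' : (n <= m)%N -> (j <= l m)%N -> (m <= m')%N ->
    anc j b m -> anc j b m'.
  move=> nm jm mm' [bF bh]; split=> //.
  by apply: (fstars1_trans jm (lle _ _ mm') bh); exact: hh.
have anc_uniq j b b' m m' : (n <= m)%N -> (n <= m')%N -> (j <= l m)%N ->
    (j <= l m')%N -> anc j b m -> anc j b' m' -> b = b'.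
  move=> nm nm' jm jm' bm bm'.
  have [bF b1] := ancS _ _ _ (maxn m m') nm jm (leq_maxl _ _) bm.
  have [b'F b2] := ancS _ _ _ (maxn m m') nm' jm' (leq_maxr _ _) bm'.
  apply: fstars1_inj bF b'F b1 b2.
  exact: leq_trans jm (lle _ _ (leq_maxl _ _)).
have /choice[a aP] p : exists b, anc (l n + p)%N b (n + p)%N.
  have le : (l n + p <= l (n + p))%N.
    elim: p => [|p IH]; first by rewrite !addn0.
    by rewrite !addnS; apply: leq_ltn_trans IH (lmono _ _ _).
  have := hh n (n + p)%N (leqnn _) (leq_addr _ _).
  move=> /(fstars1_split (leq_addr _ _) le)[b hb bh]; exists b; split=> //.
  exact: fstars1_sub (leq_addr _ _) hF hb.
have lp p : (l n + p <= l (n + p))%N.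
  elim: p => [|p IH]; first by rewrite !addn0.
  by rewrite !addnS; apply: leq_ltn_trans IH (lmono _ _ _).
have [||x xP] := @pos_realize (l n) a.
- by have [] := aP 0%N; rewrite addn0.
- move=> p.
  have [bF b1] := ancS _ _ _ (n + p).+1 (leq_addr _ _) (lp p) (leqnSn _) (aP p).
  have := lp p.+1; rewrite !addnS => lpS.
  have [b ab bh] := fstars1_split (leqnSn _) lpS b1.
  suff -> : a p.+1 = b by [].
  apply: (anc_uniq (l n + p).+1 _ _ (n + p).+1 (n + p).+1) => //; 
    try by rewrite -addnS leq_addr.
    by have := aP p.+1; rewrite !addnS.
  by split=> //; apply: fstars1_sub bF ab.
exists x => m nm; have le : (l n <= l m)%N := lle _ _ nm.
have := xP (l m - l n)%N; rewrite subnKC//.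
suff -> : a (l m - l n)%N = h m by [].
set p := (l m - l n)%N; have ep : (l n + p = l m)%N by rewrite subnKC.
have aPp : anc (l m) (a p) (n + p)%N by rewrite -ep.
apply: (anc_uniq (l m) _ _ (n + p)%N m) => //; rewrite ?leq_addr//.
  by rewrite -ep.
split; last by rewrite fstars_id inE.
exact: fstars1_sub le hF (hh n m (leqnn _) nm).
Qed.

(** In the inductive limit, openness means openness of the trace on each X_n. Around a path, a basic
    neighbourhood fixes the head and finitely many blocks, which amounts to fixing one position at a
    later level. *)
Lemma CF_openP (U : set (CF_X T)) : open U <->
  (forall x, U x -> exists n f, pos n x f /\ forall y, pos n y f -> U y).
Proof.
split=> [oU x Ux|H].
  have [n [u [Xu ex]]] := CF_pointP x; subst x.
  have /sigT_openP/(_ n)[W oW eW] : open (\pi_({eq_quot (@CF_eqv G k T)})%qT @^-1` U).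
    by [].
  have Wu : W u.
    have : (set_val @^-1` W) (SigSub (mem_set Xu) : set_type (CF_Xn T n)).
      by rewrite eW.
    by [].
  have /nbhs_CF_pathP[p pP] : nbhs u W by apply: open_nbhs_nbhs.
  exists (n + p)%N, (pathprod u p); split; first exact: pos_CF_point.
  move=> y yp; have [uF uC uc] := Xu.
  have yn : pos n y u.1.
    exact: pos_pred (leq_addr _ _) uF (CF_Xn_pathprod p Xu) yp.
  have [v [Xv [yv vu]]] := yn; have [vF vC vc] := Xv.
  have : W v.
    apply: pP => // j jp.
    have uv i : (i <= p)%N -> pathprod v i = pathprod u i.
      move=> ip; have ypi : pos (n + i) y (pathprod u i).
        apply: pos_pred yp; first by rewrite leq_add2l.
          exact: CF_Xn_pathprod_F.
        apply: pos_pos_fstars (pos_CF_point Xu i) (pos_CF_point Xu p).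
        by rewrite leq_add2l.
      apply: pos_uniq ypi; rewrite -yv; exact: pos_CF_point.
    have := uv j.+1 jp; rewrite !pathprodS => e.
    by have [] := CF_star_inj (CF_Xn_pathprod_F j Xv) (CF_Xn_pathprod_F j Xu)
      (vC j) (uC j) (vc j) (uc j) e.
  move=> Wv.
  have : (set_val @^-1` W) (SigSub (mem_set Xv) : set_type (CF_Xn T n)) by [].
  by rewrite eW -yv.
suff : open (\pi_({eq_quot (@CF_eqv G k T)})%qT @^-1` U) by [].
apply/sigT_openP => n.
(* The trace of [U] on X_n is cut out by this set of ambient paths. It is open because its condition
   at [v] involves only the head and finitely many blocks. *)
exists [set v | exists p, forall w, forall Xw : CF_Xn T n w, w.1 = v.1 ->
  (forall j, (j < p)%N -> w.2 j = v.2 j) -> U (CF_point Xw)]; last first.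
  apply/seteqP; split=> [[v Xv] /= [p /(_ v (set_mem Xv) erefl) H']|].
    have := H' (fun _ _ => erefl); rewrite /CF_point /CF_in.
    by have -> : SigSub (mem_set (set_mem Xv)) = exist _ v Xv by exact: val_inj.
  move=> [v Xv] /= Uv; have Xv' := set_mem Xv.
  have Uv' : U (CF_point Xv').
    move: Uv; rewrite /CF_point /CF_in.
    by have -> : SigSub (mem_set Xv') = exist _ v Xv by exact: val_inj.
  (* Fixing [m] blocks is enough. If n <= m, the position at level [m] uses m - n of them; if m < n,
     then [f] is an ancestor of the head. *)
  have [m [f [xf fU]]] := H _ Uv'; exists m => w Xw e1 e2; apply: fU.
  have pe q : (q <= m)%N -> pathprod w q = pathprod v q.
    elim: q => [_|q IH qm]; first by rewrite /pathprod /= e1.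
    by rewrite !pathprodS IH ?e2// ltnW.
  have [le|/ltnW le] := leqP n m; last first.
    apply: pos_pred le (pos_mem xf) (pos_pos_fstars le xf (pos_CF_point0 Xv')) _.
    by have := pos_CF_point0 Xw; rewrite e1.
  have := pos_CF_point Xv' (m - n); rewrite subnKC// => /pos_uniq/(_ xf) <-.
  by have := pos_CF_point Xw (m - n); rewrite subnKC// pe// leq_subr.
rewrite openE => v [p Hp]; apply/nbhs_CF_pathP; exists p => v' e1 e2.
exists p => w Xw e3 e4; apply: Hp; first by rewrite e3.
by move=> j jp; rewrite e4// e2.
Qed.

End Positions.

(** * Topology, Borel sets and action *)

Section Topology.
Context {G : groupType} {k : nat}.
Implicit Types (f h : Gl G k) (A : {fset Gl G k}) (g : G).
Variable T : CFseq G k.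
Implicit Types (x y : CF_X T).
Local Notation C := (CF_C T).

Lemma open_CF_cyl n A : open (@CF_cyl G k T n A : set (CF_X T)).
Proof.
apply/CF_openP => x /CF_cylE[f fA xf]; exists n, f; split=> // y yf.
by apply/CF_cylE; exists f.
Qed.

(** By [pos_ext], distinct points have different positions from some level on, and cylinders at
    different positions of one level are disjoint. *)
Lemma CF_X_hausdorff : hausdorff_space (CF_X T).
Proof.
rewrite open_hausdorff => x y /eqP xy.
have [N HN] : exists N, forall m f, (N <= m)%N -> pos m x f -> ~ pos m y f.
  apply: contrapT => /forallNP H; apply: xy; apply: pos_ext => N.
  have := H N; move/existsNP => [m /existsNP[f]].
  move=> /not_implyP[Nm /not_implyP[xf /contrapT yf]].
  by exists m => //; exists f.
have [n [f xf]] := pos_ex x; have [n' [f' yf']] := pos_ex y.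
pose m := maxn N (maxn n n').
have [||h xh _] := @pos_fstars _ _ T n m x f; rewrite ?leq_max ?leqnn ?orbT//.
have [||h' yh' _] := @pos_fstars _ _ T n' m y f'; rewrite ?leq_max ?leqnn ?orbT//.
exists (CF_cyl m [fset h]%fset, CF_cyl m [fset h']%fset) => /=.
  by split; rewrite inE; apply/CF_cyl1E.
split; try exact: open_CF_cyl; apply/eqP/seteqP; split=> // z [].
move=> /CF_cyl1E zh /CF_cyl1E zh'; apply: (HN m h) => //; first exact: leq_maxl.
by rewrite (pos_uniq zh zh').
Qed.

(* Koenig's lemma: a cylinder without finite subcover contains a smaller one. *)
Lemma compact_CF_cyl n A : compact (@CF_cyl G k T n A : set (CF_X T)).
Proof.
rewrite compact_cover => I D F oF cov.
pose fsc := finite_subset_cover D F.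
have fscU (B : {fset Gl G k}) (P : Gl G k -> set (CF_X T)) :
    (forall f, f \in B -> fsc (P f)) -> fsc (\bigcup_(f in [set` B]) P f).
  move=> H.
  have /choice[D' D'P] f : exists D' : {fset I}, f \in B ->
      {subset D' <= D} /\ P f `<=` cover [set` D'] F.
    have [fB|_] := boolP (f \in B); last by exists fset0.
    by have [D' ? ?] := H f fB; exists D'.
  exists (\bigcup_(f <- B) D' f)%fset => [i|x [f fB Px]].
    by move=> /bigfcupP[f /andP[fB _]]; apply: (D'P f fB).1.
  have [_ /(_ _ Px)[i iD' Fi]] := D'P f fB; exists i => //=.
  by apply/bigfcupP; exists f => //; rewrite fB.
pose P n f := [set x : CF_X T | pos n x f].
have fscS B B' : B `<=` B' -> fsc B' -> fsc B.
  by move=> BB' [D' ? c]; exists D' => //; exact: subset_trans BB' c.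
suff H f : f \in A -> fsc (P n f).
  by apply: fscS (fscU _ _ H) => x /CF_cylE[f fA xf]; exists f.
move=> fA; apply: contrapT => bad0.
(* A position outside F_m has an empty cylinder, which the empty family covers. *)
have badF m h : ~ fsc (P m h) -> h \in CF_F T m.
  move=> bad; apply: contrapT => hF; apply: bad; exists fset0 => //.
  by move=> x /pos_mem.
have /choice[nx nxP] (q : nat * Gl G k) : exists h, ~ fsc (P q.1 q.2) ->
    h \in fstars C [fset q.2]%fset q.1 q.1.+1 /\ ~ fsc (P q.1.+1 h).
  have [?|bad] := pselect (fsc (P q.1 q.2)); first by exists q.2.
  apply: contrapT => /forallNP H; apply: bad.
  apply: fscS (fscU (fstars C [fset q.2]%fset q.1 q.1.+1) (P q.1.+1) _).
    by move=> x /(pos_fstars (leqnSn _))[h xh hq]; exists h.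
  by move=> h hq; apply: contrapT => bad; apply: (H h).
pose a := fix a p := if p is p'.+1 then nx ((n + p')%N, a p') else f.
have bad p : ~ fsc (P (n + p)%N (a p)).
  elim: p => [|p IH]; first by rewrite addn0.
  by rewrite addnS; have [] := nxP ((n + p)%N, a p) IH.
have [||x xP] := @pos_realize _ _ T n a.
- by apply: badF; have := bad 0%N; rewrite addn0.
- by move=> p; have [] := nxP ((n + p)%N, a p) (bad p).
have [i Di Fi] : cover D F x.
  by apply: cov; apply/CF_cylE; exists f => //; have := xP 0%N; rewrite addn0.
have [m [h [xh hF]]] := (CF_openP _).1 (oF i Di) _ Fi.
(* The bad branch is indexed by the levels n + p. Level n + m is beyond [m], so its bad cylinder
   lies inside the one at [h] and is covered by the single set [F i]. *)
apply: (bad m); exists [fset i]%fset => [j /fset1P ->|y ym].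
  by rewrite inE.
exists i; rewrite /= ?inE//; apply: hF.
apply: pos_pred (leq_addl _ _) (pos_mem xh) _ ym.
exact: pos_pos_fstars (leq_addl _ _) xh (xP m).
Qed.

Lemma measurable_CF_open (U : set (CF_borel T)) :
  open (U : set (CF_X T)) -> measurable U.
Proof. by move=> oU; apply: sub_sigma_algebra. Qed.

Lemma measurable_CF_cyl n A : measurable (@CF_cyl G k T n A).
Proof. apply: measurable_CF_open; exact: open_CF_cyl. Qed.

Lemma closed_CF_compact (K : set (CF_X T)) : compact K -> closed K.
Proof. exact: compact_closed CF_X_hausdorff. Qed.

Lemma measurable_CF_compact (K : set (CF_borel T)) :
  compact (K : set (CF_X T)) -> measurable K.
Proof.
move=> /closed_CF_compact cK; rewrite -[K]setCK; apply: measurableC.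
apply: measurable_CF_open; exact: closed_openC.
Qed.

(** * The action read on positions, and images of Borel sets *)

Lemma CF_Xn_translate g n u (Xu : CF_Xn T n u) :
  translate g u.1 \in CF_F T n ->
  exists2 v : CF_path G k, CF_Xn T n v &
    [/\ v.1 = translate g u.1, v.2 = u.2 &
        forall p, pathprod v p = translate g (pathprod u p)].
Proof.
have [_ uC uc] := Xu; move=> gF; exists (translate g u.1, u.2).
  have pE p : pathprod ((translate g u.1, u.2) : CF_path G k) p =
              translate g (pathprod u p).
    by elim: p => [//|p IH]; rewrite !pathprodS IH translate_star.
  by split=> // l; rewrite pE; exact: uc.
by split=> //; elim=> [//|p IH]; rewrite !pathprodS IH translate_star.
Qed.

Lemma CF_action_pos g x y : CF_action g x y -> exists n, forall m, (n <= m)%N ->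
  exists2 f, pos m x f & pos m y (translate g f).
Proof.
move=> [n [u [v [<- <- e1 e2]]]]; rewrite !CF_inE; exists n => m /subnKC <-.
exists (pathprod (set_val u) (m - n)); first exact: pos_CF_point.
have <- : pathprod (set_val v) (m - n) = translate g (pathprod (set_val u) (m - n)).
  elim: (m - n)%N => [//|p IH].
  by rewrite !pathprodS IH translate_star e2.
exact: pos_CF_point.
Qed.

Lemma CF_action_ex g n x f : pos n x f -> translate g f \in CF_F T n ->
  exists2 y, CF_action g x y & pos n y (translate g f).
Proof.
move=> [u [Xu [<- <-]]] /(CF_Xn_translate Xu)[v Xv [e1 e2 _]].
exists (CF_point Xv); last by rewrite -e1; exact: pos_CF_point0.
by exists n, (SigSub (mem_set Xu)), (SigSub (mem_set Xv)).
Qed.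

(** With [CF_action_pos], this describes the graph of T_g by positions. Infinitely many levels
    suffice: T_g [x] exists as soon as one translated position is admissible, and [pos_ext]
    identifies it with [y]. *)
Lemma pos_CF_action g x y :
  (forall N, exists2 m, (N <= m)%N &
     exists2 f, pos m x f & pos m y (translate g f)) -> CF_action g x y.
Proof.
move=> H; have [n _ [f xf yf]] := H 0%N.
have [y' xy' y'f] := CF_action_ex xf (pos_mem yf).
suff -> : y = y' by [].
have [n' Hn'] := CF_action_pos xy'.
apply: pos_ext => N; have [m le [h xh yh]] := H (maxn N n').
exists m; first exact: leq_trans (leq_maxl _ _) le.
have [h' xh' y'h'] := Hn' m (leq_trans (leq_maxr _ _) le).
by exists (translate g h); rewrite {2}(pos_uniq xh xh').
Qed.

Lemma CF_action_inj g x y y' : CF_action g x y -> CF_action g x y' -> y = y'.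
Proof.
move=> /CF_action_pos[n H] /CF_action_pos[n' H']; apply: pos_ext => N.
exists (maxn N (maxn n n')); first exact: leq_maxl.
have [|f xf yf] := H (maxn N (maxn n n')); first by rewrite !leq_max leqnn ?orbT.
have [|f' xf' yf'] := H' (maxn N (maxn n n')); first by rewrite !leq_max leqnn ?orbT.
by exists (translate g f); split=> //; rewrite (pos_uniq xf xf').
Qed.

Lemma CF_actionV g x y : CF_action g x y -> CF_action g^-1%g y x.
Proof.
move=> /CF_action_pos[n H]; apply: pos_CF_action => N.
exists (maxn N n); first exact: leq_maxl.
have [f xf yf] := H (maxn N n) (leq_maxr _ _).
by exists (translate g f) => //; rewrite translateK.
Qed.

(** At a level where [x] has position [h] and its image has position g h, T_g carries the whole
    cylinder at [h] onto the cylinder at g h. *)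
Lemma open_act_image g (U : set (CF_X T)) :
  open U -> open (act_image (@CF_action G k T) g U : set (CF_X T)).
Proof.
move=> oU; apply/CF_openP => y [x Ux xy].
have [n [f [xf fU]]] := (CF_openP _).1 oU _ Ux.
have [n' H] := CF_action_pos xy.
have [h xh yh] := H (maxn n n') (leq_maxr _ _).
exists (maxn n n'), (translate g h); split=> // y' y'h.
have hF : translate g^-1%g (translate g h) \in CF_F T (maxn n n').
  by rewrite translateK; exact: pos_mem xh.
have [x' y'x'] := CF_action_ex y'h hF; rewrite translateK => x'h.
exists x'; last by rewrite -(invgK g); exact: CF_actionV.
apply/fU; apply: pos_pred (leq_maxl _ _) (pos_mem xf) _ x'h.
exact: pos_pos_fstars (leq_maxl _ _) xf xh.
Qed.

Lemma measurable_act_image g (B : set (CF_borel T)) :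
  measurable B -> measurable (act_image (@CF_action G k T) g B).
Proof.
pose M := [set B : set (CF_borel T) |
  measurable (act_image (@CF_action G k T) g B)].
suff sM : <<s (@open (CF_X T)) >> `<=` M by move=> mB; exact: sM.
apply: smallest_sub => [|U oU]; last first.
  by apply: measurable_CF_open; exact: open_act_image.
split.
- rewrite /M /=; have -> : act_image (@CF_action G k T) g set0 = set0.
    by apply/seteqP; split=> // y [].
  exact: measurable0.
- move=> A MA; rewrite /M /=.
  (* T_g is only partially defined, so complements are taken inside the open image of the whole
     space; T_g being injective makes the equality hold. *)
  have -> : act_image (@CF_action G k T) g (setT `\` A) =
      act_image (@CF_action G k T) g setT `\` act_image (@CF_action G k T) g A.
    apply/seteqP; split=> [y [x [_ nAx] xy]|y [[x _ xy] nA]].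
      split; first by exists x.
      move=> [x' Ax' x'y]; apply: nAx.
      by rewrite (CF_action_inj (CF_actionV xy) (CF_actionV x'y)).
    by exists x => //; split=> // Ax; apply: nA; exists x.
  apply: measurableD => //; apply: measurable_CF_open.
  by apply: open_act_image; exact: openT.
- move=> F MF; rewrite /M /=.
  have -> : act_image (@CF_action G k T) g (\bigcup_i F i) =
      \bigcup_i act_image (@CF_action G k T) g (F i).
    apply/seteqP; split=> [y [x [i _ Fx] xy]|y [i _ [x Fx xy]]].
      by exists i => //; exists x.
    by exists x => //; exists i.
  exact: bigcupT_measurable.
Qed.

End Topology.

(** * The refined sequence and its embedding *)

Section Blocks.
Context {G : groupType} {k : nat} (T : CFseq G k).
Implicit Types (f h : Gl G k) (c : Gm G k) (A : {fset Gl G k}).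
Local Notation C := (CF_C T).

(* C_{l+1} * ... * C_m *)
Definition blocks (l m : nat) : {fset Gm G k} :=
  (\bigcup_(i <- enum 'I_k.+1)
     [fset (i, h.1, h.2) | h in fstars C [fset (1%g, i)] l m])%fset.

(** Left translation commutes with appending blocks, so [f] may be moved to [(1, f.2)], the base
    point used in [blocks]. *)
Lemma in_blocks l m f c : (l <= m)%N -> composable f c ->
  (c \in blocks l m) = (star f c \in fstars C [fset f]%fset l m).
Proof.
move=> lm; case: f => [x i]; case: c => [[i' g] j]; rewrite /composable /= => /eqP <-.
have -> : star (x, i) (i, g, j) = translate x (g, j) by [].
have -> : (x, i) = translate x (1%g, i) :> Gl G k by rewrite /translate /= mulg1.
rewrite fstars1_translate//; apply/bigfcupP/idP => [[i1 _ /imfsetP[h /= hC]]|hC].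
  by case=> -> -> ->; case: (h) hC.
by exists i; rewrite ?mem_enum//; apply/imfsetP; exists (g, j).
Qed.

Lemma fstars1_blocks l m f h : (l <= m)%N -> h \in fstars C [fset f]%fset l m ->
  exists c, [/\ c \in blocks l m, composable f c & h = star f c].
Proof.
move=> lm fh; pose c : Gm G k := (f.2, (f.1^-1 * h.1)%g, h.2).
have fc : composable f c by rewrite /composable.
have e : h = star f c by rewrite /star /= mulVKg; case: (h).
by exists c; rewrite (in_blocks lm fc) -e.
Qed.

Variable g_ : nat -> G.

Definition good (l m : nat) c : Prop := forall j f, (j < l)%N -> f \in CF_F T l ->
  composable f c -> translate (g_ j) (star f c) \in CF_F T m.

Definition good_blocks (l m : nat) : {fset Gm G k} :=
  [fset c in blocks l m | `[< good l m c >]]%fset.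

Lemma in_good_blocks l m c :
  c \in good_blocks l m <-> c \in blocks l m /\ good l m c.
Proof.
rewrite !inE /=; split=> [/andP[-> /asboolP]//|[-> ?]]; exact/asboolP.
Qed.

End Blocks.

Section Refinement.
Context {G : groupType} {k : nat} (T : CFseq G k) (g_ : nat -> G) (l : nat -> nat).
Implicit Types (f h : Gl G k) (c : Gm G k) (A : {fset Gl G k}) (g : G).
Hypothesis l0 : l 0 = 0%N.
Hypothesis lmono : {homo l : i j / (i < j)%N}.
Hypothesis good_gt1 : forall n (i : 'I_k.+1), exists c1 c2,
  [/\ c1 \in good_blocks T g_ (l n) (l n.+1), c2 \in good_blocks T g_ (l n) (l n.+1),
      c1 != c2, c1.1.1 = i & c2.1.1 = i].

Let lle i j : (i <= j)%N -> (l i <= l j)%N.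
Proof. exact: (ltnW_homo lmono). Qed.

Let lge j : (j <= l j)%N.
Proof. by elim: j => [//|j IH]; apply: leq_ltn_trans IH (lmono _). Qed.

Definition refined_C n : {fset Gm G k} :=
  if n is n'.+1 then good_blocks T g_ (l n') (l n) else fset0.

Lemma refined_F0 : CF_F T (l 0) = [fset (1%g, i) | i : 'I_k.+1]%fset.
Proof. by rewrite l0; exact: CF_F0. Qed.

Lemma refined_C_gt1 n i : (1 < \sum_(j < k.+1) #|` slice2 (refined_C n.+1) i j|)%N.
Proof.
rewrite sum_card_slice2; apply/cardfs_gt1P.
have [c1 [c2 [c1C c2C c12 e1 e2]]] := good_gt1 n i.
exists c1, c2; split => //; first by rewrite !inE in c1C *; rewrite c1C e1 eqxx.
by rewrite !inE in c2C *; rewrite c2C e2 eqxx.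
Qed.

Lemma star_good_blocks n f c : c \in good_blocks T g_ (l n) (l n.+1) ->
  composable f c -> star f c \in fstars (CF_C T) [fset f]%fset (l n) (l n.+1).
Proof. by move=> /in_good_blocks[cB _] fc; rewrite -in_blocks// lle. Qed.

Lemma refined_F_sub n :
  (fstar (CF_F T (l n)) (refined_C n.+1) `<=` CF_F T (l n.+1))%fset.
Proof.
apply/fsubsetP => _ /in_fstarP[f [c [fF cC fc ->]]].
exact: fstars1_sub (lle (leqnSn n)) fF (star_good_blocks cC fc).
Qed.

(** A common element of the two copies has only one ancestor in F_(l n), hence the same left factor
    in both products; left cancellation gives equal blocks. *)
Lemma refined_F_disj n c c' : c \in refined_C n.+1 -> c' \in refined_C n.+1 ->
  c != c' ->
  (fstar (CF_F T (l n)) [fset c] `&` fstar (CF_F T (l n)) [fset c'] = fset0)%fset.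
Proof.
move=> cC c'C /eqP ncc; apply/fsetP => h; rewrite !inE; apply/negP => /andP[].
move=> /in_fstarP[f [_ [fF /fset1P -> fc ->]]].
move=> /in_fstarP[f' [_ [f'F /fset1P -> f'c' e]]].
have H := star_good_blocks cC fc; have H' := star_good_blocks c'C f'c'.
rewrite -e in H'; have ff := fstars1_inj (lle (leqnSn n)) fF f'F H H'.
apply: ncc; move: fc f'c' e; rewrite -ff /composable.
case: (f) c c' {cC c'C H H' ff fF}.
move=> x i [[a b] d] [[a' b'] d'] /= /eqP <- /eqP <- [/mulgI -> ->] //.
Qed.

Definition refined : CFseq G k :=
  {| CF_F := fun n => CF_F T (l n); CF_C := refined_C; CF_F0 := refined_F0;
     CF_C_gt1 := refined_C_gt1; CF_F_one := fun n => CF_F_one T (l n);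
     CF_F_sub := refined_F_sub; CF_F_disj := refined_F_disj |}.
Local Notation S := refined.

Lemma refined_fstars n m f h : (n <= m)%N ->
  h \in fstars (CF_C S) [fset f]%fset n m ->
  h \in fstars (CF_C T) [fset f]%fset (l n) (l m).
Proof.
move=> /subnKC <-; elim: (m - n)%N h => [|p IH] h.
  by rewrite !addn0 !fstars_id.
rewrite addnS fstarsS ?leq_addr// => /in_fstarP[a [c [fa cC ac ->]]].
apply: fstars1_trans (IH _ fa) (star_good_blocks cC ac); rewrite lle ?leq_addr//.
Qed.

Lemma refined_exhaustive g n : (exists j, g_ j = g) -> (0 < n)%N ->
  exists2 m, (n < m)%N &
  (fstars (CF_C S) (ftranslate g (CF_F S n)) n m `<=` CF_F S m)%fset.
Proof.
(* At stage [maxn n j.+1] the level exceeds [j], so [g_ j] is among the translations that a good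
   block has to respect; appending one more block then brings the translate into F. *)
move=> [j <-] n0; exists (maxn n j.+1).+1; first by rewrite ltnS leq_maxl.
set m := maxn n j.+1; have nm : (n <= m)%N := leq_maxl _ _.
rewrite fstarsS// -ftranslate_fstars// -ftranslate_fstar.
apply/fsubsetP => h; rewrite in_ftranslate => /in_fstarP[f [c [fF cC fc e]]].
have -> : h = translate (g_ j) (star f c) by rewrite -e translateKV.
have /in_good_blocks[_ cg] := cC; apply: cg => //.
  by apply: leq_trans (lge m); exact: leq_maxr.
have := @fstars_sub _ _ S (CF_F S n) n m nm (fsubset_refl _).
by move=> /fsubsetP/(_ _ fF).
Qed.

(** * The embedding of the refined space into the original one *)

Definition matches (y : CF_X S) (x : CF_X T) : Prop :=
  forall n f, pos n y f -> pos (l n) x f.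

(** The positions of [y] from some stage on form a chain along the levels [l], realized by a point
    of X. Agreement at earlier stages follows by passing to ancestors. *)
Lemma matches_ex y : exists x, matches y x.
Proof.
have [n0 [f0 yf0]] := pos_ex y.
have /choice[h hP] m : exists h, (n0 <= m)%N -> pos m y h.
  have [le|] := leqP n0 m; last by exists f0.
  by have [h yh _] := pos_fstars le yf0; exists h.
have [|m le|x xP] := @pos_realize_sub _ _ T l n0 h lmono.
- exact: (pos_mem (hP n0 (leqnn _))).
- apply: refined_fstars => //; apply: pos_pos_fstars (hP _ le) (hP _ _) => //.
  exact: leq_trans le _.
exists x => n f yf.
have ym := hP _ (leq_maxr n n0).
apply: pos_pred (lle (leq_maxl n n0)) (pos_mem yf) _ (xP _ (leq_maxr _ _)).
apply: refined_fstars; first exact: leq_maxl.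
exact: pos_pos_fstars (leq_maxl _ _) yf ym.
Qed.

(** Chosen among the matching points; [embed_eq] shows that there is only one. *)
Definition embed (y : CF_borel S) : CF_borel T := sval (cid (matches_ex y)).

Lemma embedP y : matches y (embed y).
Proof. by rewrite /embed; case: cid. Qed.

Lemma pos_large (T' : CFseq G k) (x : CF_X T') :
  exists n, forall m, (n <= m)%N -> exists f, pos m x f.
Proof.
have [n [f xf]] := pos_ex x; exists n => m /pos_fstars/(_ xf)[h xh _].
by exists h.
Qed.

Lemma embed_eq y x : matches y x -> embed y = x.
Proof.
move=> yx; apply: pos_ext => N; have [n nP] := pos_large y.
have [f yf] := nP (maxn N n) (leq_maxr _ _).
exists (l (maxn N n)); first by apply: leq_trans (lge _); exact: leq_maxl.
by exists f; split; [exact: embedP|exact: yx].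
Qed.

Lemma embed_inj : injective embed.
Proof.
move=> y y' e; apply: pos_ext => N; have [n nP] := pos_large y.
have [n' n'P] := pos_large y'; pose m := maxn N (maxn n n').
have [f yf] : exists f, pos m y f by apply: nP; rewrite !leq_max leqnn orbT.
have [f' yf'] : exists f, pos m y' f by apply: n'P; rewrite !leq_max leqnn !orbT.
exists m; first exact: leq_maxl.
exists f; split=> //; have xf := embedP yf; rewrite e in xf.
by rewrite (pos_uniq xf (embedP yf')).
Qed.

(* The points whose [m]-th block is good. *)
Definition good_set m : set (CF_borel T) :=
  CF_cyl (l m.+1) (fstar (CF_F T (l m)) (good_blocks T g_ (l m) (l m.+1))).

Definition eventually_good : set (CF_borel T) :=
  \bigcup_n \bigcap_(m in [set m | (n <= m)%N]) good_set m.

Lemma good_set_embed y n m f : pos n y f -> (n <= m)%N -> good_set m (embed y).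
Proof.
move=> yf nm; have [h yh fh] := pos_fstars nm yf.
have [h' yh'] := pos_fstars (leqnSn m) yh => /fstars1_stepP[c [cC hc e]].
apply/CF_cylE; exists h'; last exact: embedP.
by apply/in_fstarP; exists h, c; split=> //; exact: pos_mem yh.
Qed.

Lemma good_set_pos m x : good_set m x -> exists2 f, pos (l m) x f &
  exists c, [/\ c \in good_blocks T g_ (l m) (l m.+1), composable f c &
                pos (l m.+1) x (star f c)].
Proof.
move=> /CF_cylE[h /in_fstarP[f [c [fF cC fc ->]]] xh].
exists f; last by exists c.
exact: pos_pred (lle (leqnSn m)) fF (star_good_blocks cC fc) xh.
Qed.

(** From stage [n] on, the good blocks of [x] are blocks of the refined sequence, so they form a
    path of the refined space starting at [f]. *)
Lemma embed_surj n x f : pos (l n) x f ->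
  (forall m, (n <= m)%N -> good_set m x) -> exists2 y, embed y = x & pos n y f.
Proof.
move=> xf xE.
have /choice[h hP] m : exists h, (n <= m)%N -> pos (l m) x h.
  have [le|] := leqP n m; last by exists f.
  by have [h ? _] := good_set_pos (xE m le); exists h.
have [||y yP] := @pos_realize _ _ S n (fun p => h (n + p)%N).
- by rewrite addn0; exact: pos_mem (hP n (leqnn n)).
- move=> p; have le := leq_addr p n.
  have [f' xf' [c [cC fc xc]]] := good_set_pos (xE _ le).
  rewrite addnS (pos_uniq (hP _ (leqW le)) xc) (pos_uniq (hP _ le) xf').
  exact: fstars1_step.
exists y; last first.
  by have := yP 0%N; rewrite addn0 (pos_uniq (hP n (leqnn n)) xf).
apply: embed_eq => n' f' yf'.
have ym := yP n'; have xm := hP _ (leq_addr n' n).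
apply: pos_pred (lle (leq_addl n n')) (pos_mem yf') _ xm.
apply: refined_fstars; first exact: leq_addl.
exact: pos_pos_fstars (leq_addl _ _) yf' ym.
Qed.

Lemma embed_cyl n A : (A `<=` CF_F T (l n))%fset ->
  embed @` CF_cyl n A =
  CF_cyl (l n) A `&` \bigcap_(m in [set m | (n <= m)%N]) good_set m.
Proof.
move=> AF; apply/seteqP; split=> [x [y /CF_cylE[f fA yf] <-]|x].
  split=> [|m /= nm]; last exact: good_set_embed yf nm.
  by apply/CF_cylE; exists f => //; exact: embedP.
move=> [/CF_cylE[f fA xf] xE]; have [y yx yf] := embed_surj xf xE.
by exists y => //; apply/CF_cylE; exists f.
Qed.

Lemma range_embed : range embed = eventually_good.
Proof.
apply/seteqP; split=> [x [y _ <-]|x [n _ xE]].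
  have [n [f yf]] := pos_ex y; exists n => // m /= nm.
  exact: good_set_embed yf nm.
have [f xf _] := good_set_pos (xE n (leqnn n)).
by have [y <- _] := embed_surj xf xE; exists y.
Qed.

(** The cylinder of [y] at stage m goes into the cylinder of its image at level [l m], and since l m
    >= m this becomes arbitrarily fine. *)
Lemma embed_continuous : continuous (embed : CF_X S -> CF_X T).
Proof.
apply/continuousP => U oU; apply/CF_openP => y /= Uy.
have [n [f [xf fU]]] := (CF_openP _).1 oU _ Uy; have [n' n'P] := pos_large y.
have [h yh] := n'P (maxn n n') (leq_maxr _ _).
exists (maxn n n'), h; split=> // y' y'h; apply: fU.
have le : (n <= l (maxn n n'))%N by apply: leq_trans (lge _); exact: leq_maxl.
apply: (pos_pred le (pos_mem xf) _ (embedP y'h)).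
exact: pos_pos_fstars le xf (embedP yh).
Qed.

Lemma embed_action g y y' : CF_action g y y' -> CF_action g (embed y) (embed y').
Proof.
move=> /CF_action_pos[n H]; apply: pos_CF_action => N.
exists (l (maxn N n)); first by apply: leq_trans (lge _); exact: leq_maxl.
by have [f yf y'f] := H _ (leq_maxr N n); exists f; exact: embedP.
Qed.

Lemma refined_action_total g (y : CF_borel S) : (exists j, g_ j = g) ->
  exists y', CF_action g y y'.
Proof.
(* The position is taken at stage [n.+1] because [refined_exhaustive] asks for a positive stage. *)
move=> gE; have [n nP] := pos_large y; have [f yf] := nP n.+1 (leqnSn n).
have [m nm /fsubsetP sm] := refined_exhaustive gE (ltn0Sn n).
have [h yh fh] := pos_fstars (ltnW nm) yf.
have [|y' ? _] := @CF_action_ex _ _ S g m y h yh; last by exists y'.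
apply: sm; rewrite -ftranslate_fstars ?(ltnW nm)// in_ftranslate translateK.
by apply/in_fstarsP; [exact: ltnW|exists f => //; exact: pos_mem yf].
Qed.

(** One inclusion is equivariance. For the other, the refined action of the inverse of [g] is
    defined at every point, and its value must embed to the given preimage under T_g. *)
Lemma act_image_embed g (B : set (CF_borel T)) :
  (exists j, g_ j = g) -> (exists j, g_ j = g^-1%g) ->
  act_image (@CF_action G k S) g (embed @^-1` B) =
  embed @^-1` act_image (@CF_action G k T) g B.
Proof.
move=> gE gVE; apply/seteqP; split=> [y' [y By yy']|y' [x Bx xy']].
  by exists (embed y) => //; exact: embed_action.
have [y y'y] := refined_action_total y' gVE.
exists y; last by rewrite -(invgK g); exact: CF_actionV.
by rewrite /= (CF_action_inj (embed_action y'y) (CF_actionV xy')).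
Qed.

End Refinement.

(** * Choice of the levels *)

Section Weight.
Context {R : realType} {G : groupType} {k : nat}.
Implicit Types (f h : Gl G k) (A B : {fset Gl G k}) (lam : 'cV[R]_k.+1).

Lemma weightE lam A : weight lam A = \sum_(f <- A) lam f.2 ord0.
Proof.
rewrite [RHS](@partition_big _ _ _ _ _ 'I_k.+1 predT (fun f : Gl G k => f.2) predT)//=.
apply: eq_bigr => i _.
transitivity (\sum_(f <- A | f.2 == i) lam i ord0); last by apply: eq_bigr => f /eqP ->.
rewrite big_fset_condE big_const_seq count_predT iter_addr_0 -[RHS]mulr_natl.
by congr (#|` _|%:R * _); apply/fsetP => f; rewrite !inE.
Qed.

Lemma weightID lam A B : weight lam A =
  weight lam (A `&` B)%fset + weight lam (A `\` B)%fset.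
Proof.
have -> : (A `&` B = [fset f in A | f \in B])%fset.
  by apply/fsetP => f; rewrite !inE.
have -> : (A `\` B = [fset f in A | f \notin B])%fset.
  by apply/fsetP => f; rewrite !inE andbC.
by rewrite !weightE -!big_fset_condE [LHS](bigID (mem B)).
Qed.

Lemma weight1 lam f : weight lam [fset f]%fset = lam f.2 ord0.
Proof. by rewrite weightE big_seq_fset1. Qed.

Lemma weight0 lam : weight lam (fset0 : {fset Gl G k}) = 0.
Proof. by rewrite weightE big_seq_fset0. Qed.

Lemma weight_translate lam g A : weight lam (ftranslate g A) = weight lam A.
Proof.
rewrite !weightE big_imfset//= => f h _ _; exact: translate_inj.
Qed.

Section Positive.
Variable lam : 'cV[R]_k.+1.
Hypothesis lam0 : forall i, 0 < lam i ord0.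

Lemma weight_ge0 A : 0 <= weight lam A.
Proof. by rewrite weightE; apply: sumr_ge0 => f _; exact: ltW. Qed.

Lemma weight_sub A B : (A `<=` B)%fset -> weight lam A <= weight lam B.
Proof.
move=> /fsetIidPr AB; rewrite (weightID _ B A) AB lerDl; exact: weight_ge0.
Qed.

Lemma weight_cover (I : Type) (r : seq I) (X : I -> {fset Gl G k}) A :
  (forall f, f \in A -> has (fun i => f \in X i) r) ->
  weight lam A <= \sum_(i <- r) weight lam (X i).
Proof.
elim: r A => [|i r IH] A H.
  have -> : A = fset0 by apply/fsetP => f; rewrite in_fset0; apply/negP => /H.
  by rewrite weight0 big_nil.
rewrite big_cons (weightID _ A (X i)); apply: lerD.
  by apply: weight_sub; exact: fsubsetIr.
by apply: IH => f; rewrite !inE => /andP[fX /H /=]; rewrite (negbTE fX).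
Qed.

End Positive.
End Weight.

(** * Mass of the bad blocks and choice of a sparse sequence of levels *)

Section Selection.
Context {R : realType} {G : groupType} {k : nat} (T : CFseq G k).
Variables (lam : nat -> 'cV[R]_k.+1) (mu : {measure set (CF_borel T) -> \bar R}).
Hypotheses (Hlam : CF_weights T lam) (Hmu : CF_measure lam mu).
Hypothesis Hlim : forall (g : G) (n : nat), (0 < n)%N ->
  weight (lam m) (fstars (CF_C T) (ftranslate g (CF_F T n)) n m `&` CF_F T m)%fset
    @[m --> \oo] --> weight (lam n) (CF_F T n).
Variable g_ : nat -> G.
Implicit Types (f h : Gl G k) (A : {fset Gl G k}).
Local Notation C := (CF_C T).

Let lam0 n i : 0 < lam n i ord0. Proof. by have [] := Hlam. Qed.

Lemma CF_cyl_fstars n m A : (n <= m)%N -> (A `<=` CF_F T n)%fset ->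
  CF_cyl n A = CF_cyl m (fstars C A n m) :> set (CF_borel T).
Proof.
move=> nm AF; apply/seteqP; split=> x /CF_cylE[f fA xf]; apply/CF_cylE.
  have [h xh fh] := pos_fstars nm xf; exists h => //.
  by apply/in_fstarsP => //; exists f.
have /(in_fstarsP _ _ _ nm)[f' f'A ff'] := fA; exists f' => //.
by apply: (pos_pred nm _ ff' xf); exact: (fsubsetP AF).
Qed.

(** Both sides are the mass of one cylinder, read at levels [m] and [n]. *)
Lemma weight_fstars n m A : (n <= m)%N -> (A `<=` CF_F T n)%fset ->
  weight (lam m) (fstars C A n m) = weight (lam n) A.
Proof.
move=> nm AF; have [_ muE] := Hmu; apply: EFin_inj.
by rewrite -!muE ?(CF_cyl_fstars nm AF)//; exact: fstars_sub.
Qed.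

Lemma weight_fstars_translate g n m : (n <= m)%N ->
  weight (lam m) (fstars C (ftranslate g (CF_F T n)) n m) =
  weight (lam n) (CF_F T n).
Proof.
by move=> nm; rewrite -ftranslate_fstars// weight_translate weight_fstars.
Qed.

Definition bad_blocks l m : {fset Gm G k} :=
  (blocks T l m `\` good_blocks T g_ l m)%fset.

(** At level 0 no index j < 0 imposes a condition. This settles the first step of the subsequence,
    since the limit hypothesis concerns positive levels. *)
Lemma bad_blocks0 m : bad_blocks 0 m = fset0.
Proof.
apply/fsetP => c; rewrite !inE; apply/negP => /andP[/negP nc cb]; apply: nc.
by rewrite cb; apply/asboolP.
Qed.

(* If [f * c] leaves F_m after translation by [g], then any [f0 * c] is a
   translate of a point of (g F_l * C_{l+1} * ... * C_m) minus F_m. *)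
Lemma weight_bad_blocks l m : (l <= m)%N ->
  weight (lam m) (fstar (CF_F T l) (bad_blocks l m)) <=
  \sum_(p <- [seq (q, j) | q <- [seq (f0, f) | f0 <- CF_F T l, f <- CF_F T l],
                           j <- iota 0 l])
    (weight (lam l) (CF_F T l) - weight (lam m)
       (fstars C (ftranslate (g_ p.2) (CF_F T l)) l m `&` CF_F T m)%fset).
Proof.
move=> lm.
pose D j := (fstars C (ftranslate (g_ j) (CF_F T l)) l m `\` CF_F T m)%fset.
(* For p = ((f0, f), j), this translation carries g_j f c to f0 c. It preserves weight, so each
   [X p] weighs as much as the part of the translated tower that leaves F_m. *)
pose X (p : Gl G k * Gl G k * nat) :=
  ftranslate (p.1.1.1 * (p.1.2.1)^-1 * (g_ p.2)^-1)%g (D p.2).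
have XE p : weight (lam m) (X p) = weight (lam l) (CF_F T l) - weight (lam m)
    (fstars C (ftranslate (g_ p.2) (CF_F T l)) l m `&` CF_F T m)%fset.
  rewrite weight_translate -(weight_fstars_translate (g_ p.2) lm).
  by rewrite (weightID _ (fstars _ _ _ _) (CF_F T m)) addrAC subrr add0r.
rewrite -(eq_bigr _ (fun p _ => XE p)); apply: weight_cover => // h.
move=> /in_fstarP[f0 [c [f0F + f0c ->]]]; rewrite !inE => /andP[ng cb].
have [j [f [jl fF fc gF]]] : exists j f, [/\ (j < l)%N, f \in CF_F T l,
    composable f c & translate (g_ j) (star f c) \notin CF_F T m].
  apply: contrapT => H; move/negP: ng; apply; rewrite cb; apply/asboolP.
  move=> j f jl fF fc; apply: contrapT => /negP nF; apply: H.
  by exists j, f.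
apply/hasP; exists ((f0, f), j).
  apply/allpairsP; exists ((f0, f), j); rewrite mem_iota/= add0n; split=> //.
  by apply/allpairsP; exists (f0, f).
rewrite in_ftranslate in_fsetD /=.
have -> : translate (f0.1 * f.1^-1 * (g_ j)^-1)^-1%g (star f0 c) =
    translate (g_ j) (star f c).
  rewrite /translate /star /=; congr (_, _).
  by rewrite !invgM !invgK -!mulgA mulKg.
rewrite gF /= -ftranslate_fstars// in_ftranslate translateK.
apply/in_fstarsP => //; exists f => //.
by rewrite -in_blocks.
Qed.

(** For l > 0 the bound of [weight_bad_blocks] is a finite sum whose index set does not depend on
    [m], and each term tends to 0 by the limit hypothesis. *)
Lemma select_level l (d : R) : 0 < d -> exists2 m, (l < m)%N &
  weight (lam m) (fstar (CF_F T l) (bad_blocks l m)) < d.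
Proof.
move=> d0; have [->|l_gt0] := posnP l.
  exists 1%N => //; rewrite bad_blocks0.
  have -> : fstar (CF_F T 0) fset0 = fset0.
    by apply/fsetP => h; rewrite in_fset0; apply/in_fstarP => -[f [c []]].
  by rewrite weight0.
pose s := [seq (q, j) | q <- [seq (f0, f) | f0 <- CF_F T l, f <- CF_F T l],
                        j <- iota 0 l].
have cvg0 : (\sum_(p <- s)
    (weight (lam l) (CF_F T l) - weight (lam m)
       (fstars C (ftranslate (g_ p.2) (CF_F T l)) l m `&` CF_F T m)%fset))
    @[m --> \oo] --> (0 : R).
  rewrite [X in _ --> X](_ : 0 = \sum_(p <- s) (0 : R)); last by rewrite big1.
  apply: (@cvg_big R _ +%R 0 predT) => [|p _]; first exact: add_continuous.
  rewrite -[X in _ --> X](subrr (weight (lam l) (CF_F T l))).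
  by apply: cvgB; [exact: cvg_cst|exact: Hlim].
have [N _ HN] := cvgr_lt _ cvg0 _ d0.
exists (maxn N l.+1); first exact: leq_maxr.
apply: le_lt_trans (HN _ (leq_maxl _ _)); apply: weight_bad_blocks.
by apply: leq_trans (leq_maxr _ _).
Qed.

(** By (I), two blocks of C_(l+1) start at [i]. If all continuations of one of them were bad, the
    bad part would weigh at least a whole cylinder of level l + 1, against the assumption. So both
    have good continuations, which differ because ancestors are unique. *)
Lemma many_good_blocks l m (i : 'I_k.+1) : (l < m)%N ->
  (forall j, weight (lam m) (fstar (CF_F T l) (bad_blocks l m)) < lam l.+1 j ord0) ->
  exists c1 c2, [/\ c1 \in good_blocks T g_ l m, c2 \in good_blocks T g_ l m,
    c1 != c2, c1.1.1 = i & c2.1.1 = i].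
Proof.
move=> lm Hbad; pose e : Gl G k := (1%g, i).
have eF : e \in CF_F T l := CF_F_one T l i.
have ec c : c.1.1 = i -> composable e c by move=> ci; rewrite /composable ci.
have goodP b : b \in C l.+1 -> b.1.1 = i -> exists c, [/\ composable e c,
    c \in good_blocks T g_ l m & star e c \in fstars C [fset star e b]%fset l.+1 m].
  move=> bC /ec eb; apply: contrapT => H.
  have sF : star e b \in CF_F T l.+1.
    exact: fstars1_sub (leqnSn l) eF (fstars1_step bC eb).
  have := Hbad (star e b).2; apply/negP; rewrite -leNgt.
  rewrite -weight1 -(@weight_fstars l.+1 m) ?fsub1set//.
  apply: weight_sub => //; apply/fsubsetP => h hb.
  have hl : h \in fstars C [fset e]%fset l m.
    exact: fstars1_trans (leqnSn l) lm (fstars1_step bC eb) hb.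
  have [c [cB ec' eh]] := fstars1_blocks (ltnW lm) hl.
  apply/in_fstarP; exists e, c; split=> //.
  rewrite in_fsetD cB andbT; apply/negP => cg; apply: H.
  by exists c; rewrite -eh.
have [b1 [b2 [b1C b2C b12 b1i b2i]]] := CF_next T l i.
have [c1 [ec1 c1g c1b]] := goodP _ b1C b1i.
have [c2 [ec2 c2g c2b]] := goodP _ b2C b2i.
exists c1, c2; split=> //; try by apply/esym/eqP.
apply/eqP => e12; move/eqP: b12; apply; rewrite -e12 in c2b.
have sF b : b \in C l.+1 -> b.1.1 = i -> star e b \in CF_F T l.+1.
  move=> bC /ec eb; exact: fstars1_sub (leqnSn l) eF (fstars1_step bC eb).
have := fstars1_inj lm (sF _ b1C b1i) (sF _ b2C b2i) c1b c2b.
by move=> /(CF_star_inj eF eF b1C b2C (ec _ b1i) (ec _ b2i))[].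
Qed.

(** The minimum runs over the weights of levels 0 to l + 1 and is capped at 1. The dyadic factor
    makes the tolerances summable along the subsequence and keeps their total, from stage n on,
    below half of every weight at level [l n]. *)
Definition tolerance l : R := (2 ^+ l.+2)^-1 *
  \big[Order.min/1]_(p : 'I_l.+2 * 'I_k.+1) lam p.1 p.2 ord0.

Lemma tolerance_gt0 l : 0 < tolerance l.
Proof.
by rewrite mulr_gt0 ?invr_gt0 ?exprn_gt0//; apply: lt_bigmin.
Qed.

Lemma tolerance_le n l i : (n <= l.+1)%N ->
  tolerance l <= (2 ^+ l.+2)^-1 * lam n i ord0.
Proof.
move=> nl; rewrite ler_pM2l ?invr_gt0 ?exprn_gt0//.
have ln : (n < l.+2)%N by [].
exact: (bigmin_le_cond _ (j := (Ordinal ln, i)) (P := predT)).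
Qed.

Lemma tolerance_le1 l : tolerance l <= (2 ^+ l.+2)^-1.
Proof.
rewrite ger_pMr ?invr_gt0 ?exprn_gt0//; exact: bigmin_le_id.
Qed.

Lemma select_levels : exists l : nat -> nat, [/\ l 0 = 0%N,
  {homo l : i j / (i < j)%N} & forall n, weight (lam (l n.+1))
    (fstar (CF_F T (l n)) (bad_blocks (l n) (l n.+1))) < tolerance (l n)].
Proof.
have /choice[nx nxP] l : exists m, (l < m)%N /\
    weight (lam m) (fstar (CF_F T l) (bad_blocks l m)) < tolerance l.
  by have [m ? ?] := select_level l (tolerance_gt0 l); exists m.
exists (fun n => iter n nx 0%N); split=> // [|n]; last first.
  by have [] := nxP (iter n nx 0%N).
by apply: homo_ltn => [|n]; [exact: ltn_trans|have [] := nxP (iter n nx 0%N)].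
Qed.

End Selection.

(** * The refined measure *)

Lemma measurable_prop d (X : measurableType d) (P : Prop) :
  measurable [set _ : X | P].
Proof.
have [p|np] := pselect P.
  by rewrite (_ : mkset _ = setT)//; apply/seteqP; split.
by rewrite (_ : mkset _ = set0)//; apply/seteqP; split.
Qed.

#[local] Opaque embed.

Section RefinedMeasure.
Context {R : realType} {G : groupType} {k : nat} (T : CFseq G k).
Variables (lam : nat -> 'cV[R]_k.+1) (mu : {measure set (CF_borel T) -> \bar R}).
Hypotheses (Hlam : CF_weights T lam) (Hmu : CF_measure lam mu).
Variables (g_ : nat -> G) (l : nat -> nat).
Hypothesis l0 : l 0 = 0%N.
Hypothesis lmono : {homo l : i j / (i < j)%N}.
Hypothesis good_gt1 : forall n (i : 'I_k.+1), exists c1 c2,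
  [/\ c1 \in good_blocks T g_ (l n) (l n.+1), c2 \in good_blocks T g_ (l n) (l n.+1),
      c1 != c2, c1.1.1 = i & c2.1.1 = i].
Hypothesis bad_small : forall n, weight (lam (l n.+1))
  (fstar (CF_F T (l n)) (bad_blocks T g_ (l n) (l n.+1))) < tolerance lam (l n).
Implicit Types (f h : Gl G k) (A : {fset Gl G k}).

Let lle i j : (i <= j)%N -> (l i <= l j)%N.
Proof. exact: (ltnW_homo lmono). Qed.

Let lge j : (j <= l j)%N.
Proof. by elim: j => [//|j IH]; apply: leq_ltn_trans IH (lmono _). Qed.

Local Notation S := (refined l0 lmono good_gt1).
Local Notation embed := (@embed G k T g_ l l0 lmono good_gt1).
Let X0 : set (CF_borel T) := @eventually_good G k T g_ l.

Let embed_inj : injective embed. Proof. exact: embed_inj. Qed.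

Let range_embed : range embed = X0. Proof. exact: range_embed. Qed.

Lemma measurable_good_set m : measurable (@good_set G k T g_ l m).
Proof. exact: measurable_CF_cyl. Qed.

Lemma measurable_good_tail n :
  measurable (\bigcap_(m in [set m | (n <= m)%N]) @good_set G k T g_ l m).
Proof.
by apply: bigcap_measurable => [|m _]; [exists n => /=|exact: measurable_good_set].
Qed.

Lemma measurable_eventually_good : measurable X0.
Proof. by apply: bigcupT_measurable => n; exact: measurable_good_tail. Qed.

Lemma measurable_preimage_embed (D : set (CF_borel T)) :
  measurable D -> measurable (embed @^-1` D).
Proof.
pose M := [set D : set (CF_borel T) | measurable (embed @^-1` D)].
suff sM : <<s (@open (CF_X T)) >> `<=` M by move=> mB; exact: sM.
apply: smallest_sub => [|U oU]; last first.
  have /continuousP/(_ U oU) := @embed_continuous G k T g_ l l0 lmono good_gt1.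
  exact: measurable_CF_open.
split; rewrite /M /=.
- by rewrite preimage_set0; exact: measurable0.
- by move=> A MA; rewrite setTD preimage_setC; exact: measurableC.
- by move=> F MF; rewrite preimage_bigcup; exact: bigcupT_measurable.
Qed.

(** Sets with measurable image form a sigma-algebra, complements being handled by injectivity and
    the measurable range. It contains the open sets because images of cylinders are explicit by
    [embed_cyl]. *)
Lemma measurable_image_embed (B : set (CF_borel S)) :
  measurable B -> measurable (embed @` B).
Proof.
pose M := [set B : set (CF_borel S) | measurable (embed @` B)].
suff sM : <<s (@open (CF_X S)) >> `<=` M by move=> mB; exact: sM.
apply: smallest_sub => [|U oU].
  split; rewrite /M /=.
  - by rewrite image_set0; exact: measurable0.
  - move=> A MA.
    have -> : embed @` (setT `\` A) = X0 `\` embed @` A.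
      rewrite -range_embed; apply/seteqP; split=> [x [y [_ nAy] <-]|x [[y _ <-] nA]].
        by split; [exists y|move=> [y' Ay' /embed_inj yy]; apply: nAy; rewrite -yy].
      by exists y => //; split=> // Ay; apply: nA; exists y.
    by apply: measurableD => //; exact: measurable_eventually_good.
  - by move=> F MF; rewrite image_bigcup; exact: bigcupT_measurable.
(* An open set is the union over the levels of the finitely many cylinders of that level which it
   contains, so countably many pieces suffice. *)
pose A n := [fset f in CF_F S n | `[< (CF_cyl n [fset f]%fset `<=` U)%classic >]]%fset.
have -> : U = \bigcup_n CF_cyl n (A n).
  apply/seteqP; split=> [y /(CF_openP _).1 - /(_ oU)[n [f [yf fU]]]|y [n _]].
    exists n => //; apply/CF_cylE; exists f => //; rewrite !inE /= (pos_mem yf).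
    by apply/asboolP => z /CF_cyl1E; exact: fU.
  move=> /CF_cylE[f]; rewrite !inE /= => /andP[_ /asboolP fU] yf.
  by apply: fU; apply/CF_cyl1E.
rewrite /M /= image_bigcup; apply: bigcupT_measurable => n.
rewrite embed_cyl; last by apply/fsubsetP => f; rewrite !inE => /andP[].
by apply: measurableI; [exact: measurable_CF_cyl|exact: measurable_good_tail].
Qed.

(* Off the range of [embed], the value is junk. *)
Definition embed_inv (x : CF_borel T) : CF_borel S :=
  if pselect (exists y, embed y = x) is left e then projT1 (cid e) else point.

Lemma embed_invK y : embed_inv (embed y) = y.
Proof.
rewrite /embed_inv; case: pselect => [e|[]]; last by exists y.
exact: embed_inj (projT2 (cid e)).
Qed.

Lemma embedK x : X0 x -> embed (embed_inv x) = x.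
Proof. by rewrite -range_embed => -[y _ <-]; rewrite embed_invK. Qed.

Lemma image_embedE (B : set (CF_borel S)) : embed @` B = X0 `&` embed_inv @^-1` B.
Proof.
apply/seteqP; split=> [x [y By <-]|x [x0 Bx]].
  by split; [rewrite -range_embed; exists y|rewrite /= embed_invK].
by exists (embed_inv x) => //; exact: embedK.
Qed.

Lemma measurable_preimage_embed_inv B : measurable B -> measurable (embed_inv @^-1` B).
Proof.
move=> mB.
(* Off the range [embed_inv] is constantly [point], so that part of the preimage is either empty or
   the whole complement of [X0]. *)
have -> : embed_inv @^-1` B = embed @` B `|` (~` X0 `&` [set x | B point]).
  apply/seteqP; split=> [x Bx|x [|[nx Bp]]].
  - have [x0|nx] := pselect (X0 x); first by left; rewrite image_embedE.
    right; split=> //=; move: Bx; rewrite /embed_inv /=; case: pselect => // -[y yx].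
    by case: nx; rewrite -range_embed; exists y.
  - by rewrite image_embedE => -[].
  - rewrite /embed_inv /=; case: pselect => // -[y yx].
    by case: nx; rewrite -range_embed; exists y.
apply: measurableU; first exact: measurable_image_embed.
apply: measurableI; first by apply: measurableC; exact: measurable_eventually_good.
exact: measurable_prop.
Qed.

Lemma measurable_embed_inv : measurable_fun [set: CF_borel T] embed_inv.
Proof. by move=> _ B mB; rewrite setTI; exact: measurable_preimage_embed_inv. Qed.

#[local] Opaque embed_inv.

(** * The exceptional null set *)

Definition bad_set n : set (CF_borel T) :=
  CF_cyl (l n.+1) (fstar (CF_F T (l n)) (bad_blocks T g_ (l n) (l n.+1))).

Lemma bad_setP n x f : pos (l n) x f -> ~ @good_set G k T g_ l n x -> bad_set n x.
Proof.
move=> xf ng; have [h xh fh] := pos_fstars (lle (leqnSn n)) xf.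
have [c [cB fc e]] := fstars1_blocks (lle (leqnSn n)) fh.
apply/CF_cylE; exists h => //; apply/in_fstarP; exists f, c; split=> //.
  exact: pos_mem xf.
rewrite in_fsetD cB andbT; apply/negP => cg; apply: ng; apply/CF_cylE.
by exists h => //; apply/in_fstarP; exists f, c; split=> //; exact: pos_mem xf.
Qed.

Lemma mu_bad_set n : (mu (bad_set n) <= (tolerance lam (l n))%:E)%E.
Proof.
have [_ muE] := Hmu; rewrite muE; first by rewrite lee_fin ltW.
apply/fsubsetP => h /in_fstarP[f [c [fF + fc ->]]].
rewrite in_fsetD => /andP[_]; rewrite (in_blocks T (lle (leqnSn n)) fc).
exact: fstars1_sub (lle (leqnSn n)) fF.
Qed.

Lemma mu_not_eventually_good : mu (~` X0) = 0%E.
Proof.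
have mB n : measurable (bad_set n) by exact: measurable_CF_cyl.
apply: (@subset_measure0 _ _ _ _ _ (lim_sup_set bad_set)).
- by apply: measurableC; exact: measurable_eventually_good.
- by apply: bigcapT_measurable => n; apply: bigcup_measurable.
(* A point outside [X0] misses infinitely many good sets; once it has a position at the level
   concerned, missing a good set means lying in the bad set. *)
- move=> x nx N _; have [n nP] := pos_large x.
  apply: contrapT => H; apply: nx; exists (maxn N n) => // m /= le.
  apply: contrapT => ng; apply: H; exists m => /=.
    exact: leq_trans (leq_maxl _ _) le.
  have [|f xf] := nP (l m); last exact: bad_setP xf ng.
  by apply: leq_trans (lge _); exact: leq_trans (leq_maxr _ _) le.
apply: lim_sup_set_cvg0 => //.
apply: le_lt_trans (ltry 1).
(* The masses are compared with the series of 2^-(n+1), using l n >= n. *)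
apply: le_trans (epsilon_trick0 xpredT (@ler01 R)).
apply: lee_nneseries => // n _; apply: le_trans (mu_bad_set n) _.
rewrite lee_fin; apply: le_trans (tolerance_le1 _ _) _.
rewrite mul1r lef_pV2 ?posrE ?exprn_gt0 ?ltr0n ?expn_gt0//.
by rewrite natrX ler_eXn2l ?ltr1n// ltnW// !ltnS lge.
Qed.

Lemma mu_conull (D : set (CF_borel T)) : measurable D -> mu (X0 `&` D) = mu D.
Proof.
move=> mD; have mX := measurable_eventually_good.
rewrite -[in RHS](setIT D) -(setUv X0) setIUr measureU0//.
- by rewrite setIC.
- exact: measurableI.
- by apply: measurableI => //; exact: measurableC.
apply: (@subset_measure0 _ _ _ _ _ (~` X0)) => //.
- by apply: measurableI => //; exact: measurableC.
- exact: measurableC.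
- exact: mu_not_eventually_good.
Qed.

(** As a preimage under an everywhere defined map it inherits sigma-additivity at once. The junk
    values of [embed_inv] sit on a null set, so [refined_measureE] recovers the mass of the image
    under [embed]. *)
Definition refined_measure (B : set (CF_borel S)) : \bar R := mu (embed_inv @^-1` B).

Let refined_measure0 : refined_measure set0 = 0%E.
Proof. by rewrite /refined_measure preimage_set0 measure0. Qed.

Let refined_measure_ge0 B : (0 <= refined_measure B)%E.
Proof. exact: measure_ge0. Qed.

Let refined_measure_sigma : semi_sigma_additive refined_measure.
Proof.
move=> F mF tF mUF; rewrite /refined_measure preimage_bigcup.
apply: measure_semi_sigma_additive.
- by move=> n; exact: measurable_preimage_embed_inv.
- apply/trivIsetP => i j _ _ ij; rewrite -preimage_setI.
  by move/trivIsetP : tF => /(_ i j Logic.I Logic.I ij) ->; rewrite preimage_set0.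
- by rewrite -preimage_bigcup; exact: measurable_preimage_embed_inv.
Qed.

HB.instance Definition _ := isMeasure.Build _ _ _ refined_measure
  refined_measure0 refined_measure_ge0 refined_measure_sigma.

Lemma refined_measureE (B : set (CF_borel S)) :
  measurable B -> refined_measure B = mu (embed @` B).
Proof.
by move=> mB; rewrite image_embedE mu_conull//; exact: measurable_preimage_embed_inv.
Qed.

Lemma refined_measure_preimage (D : set (CF_borel T)) : measurable D ->
  refined_measure (embed @^-1` D) = mu D.
Proof.
move=> mD; rewrite refined_measureE; last exact: measurable_preimage_embed.
rewrite -[in RHS](mu_conull mD); congr (mu _).
apply/seteqP; split=> [x [y Dy <-]|x [x0 Dx]].
  by split=> //; rewrite -range_embed; exists y.
by exists (embed_inv x); rewrite /= embedK.
Qed.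

(** For inner regularity, a compact K inside the image of B is pulled back. Its preimage is closed
    but need not be compact, so it is cut by the compact cylinders [Z n], which exhaust the refined
    space; the masses of the cut pieces increase to that of K. *)
Lemma refined_measure_radon : radon refined_measure.
Proof.
have [[muK muR] _] := Hmu; split=> [K cK|B mB].
  rewrite refined_measureE; last exact: measurable_CF_compact.
  apply: muK; apply: continuous_compact => //; apply: continuous_subspaceT.
  exact: embed_continuous.
apply/eqP; rewrite eq_le; apply/andP; split; last first.
  apply: ge_ereal_sup => _ [K [cK KB] <-]; apply: le_measure => //; rewrite inE//.
  exact: measurable_CF_compact.
rewrite refined_measureE// muR; last exact: measurable_image_embed.
apply: ge_ereal_sup => _ [K [cK KB] <-].
have mK := measurable_CF_compact cK.
pose Z n : set (CF_borel S) := CF_cyl n (CF_F S n).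
pose Kn n : set (CF_borel T) := K `&` embed @` Z n.
have mKn n : measurable (Kn n).
  by apply: measurableI => //; apply: measurable_image_embed; exact: measurable_CF_cyl.
have ZS n m : (n <= m)%N -> Z n `<=` Z m.
  move=> nm y /CF_cylE[f _ /(pos_fstars nm)[h yh _]].
  by apply/CF_cylE; exists h => //; exact: pos_mem yh.
have KE : K = \bigcup_n Kn n.
  apply/seteqP; split=> [x Kx|x [n _ []//]].
  have [y By yx] := KB _ Kx; have [n [f yf]] := pos_ex y; exists n => //.
  by split=> //; exists y => //; apply/CF_cylE; exists f => //; exact: pos_mem yf.
have cvgK : (mu \o Kn) n @[n --> \oo] --> mu K.
  rewrite [X in mu X]KE; apply: nondecreasing_cvg_mu; first exact: mKn.
    by rewrite -KE.
  move=> n m nm; apply/subsetPset; apply: setIS; apply: image_subset; exact: ZS.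
rewrite -(cvg_lim _ cvgK)//; apply: lime_le; first by apply/cvg_ex; exists (mu K).
apply: nearW => n /=.
have cKn : compact (Z n `&` embed @^-1` K : set (CF_X S)).
  apply: compact_closedI; first exact: compact_CF_cyl.
  apply: preimage_closed; first by move=> y _; exact: embed_continuous.
  exact: closed_CF_compact.
apply: ereal_sup_ubound; exists (Z n `&` embed @^-1` K).
  split=> // y [_ Ky]; have [y' By' /embed_inj <-//] := KB _ Ky.
rewrite refined_measureE; last exact: measurable_CF_compact.
congr (mu _); apply/seteqP; split=> [x [y [Zy Ky] <-]|x [Kx [y Zy yx]]].
  by split=> //; exists y.
by exists y => //; split=> //=; rewrite yx.
Qed.

Lemma refined_measure_isomorphic : (forall g, exists j, g_ j = g) ->
  isomorphic mu (@CF_action G k T) refined_measure (@CF_action G k S).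
Proof.
move=> g_surj; exists X0, setT, embed_inv; split.
- by split; [exact: measurable_eventually_good|exact: mu_not_eventually_good].
- by rewrite setCT measure0.
- split=> [x _//||y _]; last first.
    by exists (embed y); [rewrite -range_embed; exists y|exact: embed_invK].
  by move=> x x' /set_mem x0 /set_mem x'0 e; rewrite -(embedK x0) e embedK.
- split=> [|D mD DX].
    exact: (measurable_funS measurableT (@subsetT _ _) measurable_embed_inv).
  have -> : embed_inv @` D = embed @^-1` D.
    apply/seteqP; split=> [y [x Dx <-]|y Dy].
      by rewrite /= embedK//; exact: DX.
    by exists (embed y) => //; exact: embed_invK.
  by split; [exact: measurable_preimage_embed|exact: refined_measure_preimage].
(* The refined action is everywhere defined, so the image point is computed there and embedded back;
   this also gives the invariance of [X0]. *)
move=> g x x0; have [y' yy'] := refined_action_total (embed_inv x) (g_surj g).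
exists (embed y'); split; first by rewrite -range_embed; exists y'.
- by rewrite -[x]embedK//; exact: embed_action.
- by rewrite embed_invK.
Qed.

(** The embedded cylinder is the decreasing intersection of the original cylinders over the
    positions reached from [f] by [p] refined blocks. The approximating masses are weights, for
    which invariance under translation is known. *)
Lemma refined_measure_cyl_cvg n f : f \in CF_F S n ->
  (weight (lam (l (n + p))) (fstars (CF_C S) [fset f]%fset n (n + p)))%:E
    @[p --> \oo] --> refined_measure (CF_cyl n [fset f]%fset).
Proof.
move=> fF; have [_ muE] := Hmu.
pose D p : {fset Gl G k} := fstars (CF_C S) [fset f]%fset n (n + p).
pose Q p : set (CF_borel T) := CF_cyl (l (n + p)) (D p).
have DF p : (D p `<=` CF_F T (l (n + p)))%fset.
  by apply: (@fstars_sub _ _ S); rewrite ?leq_addr// fsub1set.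
have QE : embed @` CF_cyl n [fset f]%fset = \bigcap_p Q p.
  rewrite embed_cyl ?fsub1set//; apply/seteqP; split=> [x [/CF_cyl1E xf xE] p _|x xQ].
    have [y <- yf] := embed_surj l0 lmono good_gt1 xf xE.
    have [h yh fh] := pos_fstars (leq_addr p n) yf.
    by apply/CF_cylE; exists h => //; exact: embedP.
  have xf : pos (l n) x f.
    by have := xQ 0%N Logic.I; rewrite /Q /D addn0 fstars_id => /CF_cyl1E.
  split=> [|m /= nm]; first exact/CF_cyl1E.
  (* The block appended at stage [m] shows only in the position at stage [m.+1], whence the
     successor. *)
  have := xQ (m - n).+1 Logic.I.
  rewrite /Q /D addnS subnKC// => /CF_cylE[h + xh].
  rewrite fstarsS// => /in_fstarP[a [c [fa cC ac e]]].
  apply/CF_cylE; exists h => //; apply/in_fstarP; exists a, c; split=> //.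
  exact: (fstars1_sub (T := S) nm fF fa).
have -> : refined_measure (CF_cyl n [fset f]%fset) = mu (\bigcap_p Q p).
  by rewrite refined_measureE ?QE//; exact: measurable_CF_cyl.
rewrite (_ : (fun p => _) = mu \o Q); last by apply/funext => p /=; rewrite muE.
apply: nonincreasing_cvg_mu.
- by rewrite muE ?ltry.
- by move=> p; exact: measurable_CF_cyl.
- by apply: bigcapT_measurable => p; exact: measurable_CF_cyl.
move=> p q pq; apply/subsetPset => x /CF_cylE[h fh xh].
have npq : (n + p <= n + q)%N by rewrite leq_add2l.
have [a fa ah] := fstars1_split (leq_addr p n) npq fh.
apply/CF_cylE; exists a => //.
have aF : a \in CF_F T (l (n + p)) := fsubsetP (DF p) _ fa.
by apply: (pos_pred (lle npq) aF _ xh); exact: (refined_fstars npq ah).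
Qed.

(** Positions with the same index differ by a left translation, so the approximating weights
    coincide for every p, and so do the limits. *)
Lemma refined_measure_cyl_slice n f f' :
  f \in CF_F S n -> f' \in CF_F S n -> f.2 = f'.2 ->
  refined_measure (CF_cyl n [fset f]%fset) = refined_measure (CF_cyl n [fset f']%fset).
Proof.
move=> fF f'F e.
apply: (@cvg_unique _ (@ereal_hausdorff R) _ _ _ _ (refined_measure_cyl_cvg fF)).
rewrite [X in X @ _](_ : _ = fun p => (weight (lam (l (n + p)))
    (fstars (CF_C S) [fset f']%fset n (n + p)))%:E);
  first exact: refined_measure_cyl_cvg.
apply/funext => p; congr EFin.
have -> : [fset f]%fset = ftranslate (f.1 * f'.1^-1)%g [fset f']%fset.
  apply/fsetP => h; rewrite in_ftranslate !inE (can2_eq (translateKV _) (translateK _)).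
  by congr (_ == _); rewrite /translate /= mulgVK -e; case: (f).
by rewrite -ftranslate_fstars ?leq_addr// weight_translate.
Qed.

Lemma refined_measure_cyl_lty n f :
  f \in CF_F S n -> (refined_measure (CF_cyl n [fset f]%fset) < +oo)%E.
Proof.
move=> fF; have [_ muE] := Hmu; have mc := @measurable_CF_cyl _ _ S n [fset f]%fset.
rewrite refined_measureE//; apply: (@le_lt_trans _ _ (mu (CF_cyl (l n) [fset f]%fset))).
  apply: le_measure; rewrite ?inE.
  - exact: measurable_image_embed.
  - exact: measurable_CF_cyl.
  - by rewrite embed_cyl ?fsub1set//; exact: subIsetl.
by rewrite muE ?fsub1set// ltry.
Qed.

(** Within a slice all cylinders have equal mass, and (I) puts [(1, i)] in each slice, so it serves
    as representative. *)
Definition refined_weights n : 'cV[R]_k.+1 :=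
  \col_i fine (refined_measure (CF_cyl n [fset (1%g, i)]%fset)).

Lemma refined_measure_cyl1 n f : f \in CF_F S n ->
  refined_measure (CF_cyl n [fset f]%fset) = (refined_weights n f.2 ord0)%:E.
Proof.
move=> fF; have eF : (1%g, f.2) \in CF_F S n := CF_F_one S n f.2.
rewrite mxE fineK; first exact: refined_measure_cyl_slice.
by rewrite ge0_fin_numE ?refined_measure_cyl_lty//; exact: measure_ge0.
Qed.

Lemma refined_measure_cyl n A : (A `<=` CF_F S n)%fset ->
  refined_measure (CF_cyl n A) = (weight (refined_weights n) A)%:E.
Proof.
move=> /fsubsetP AF.
have -> : CF_cyl n A =
    \big[setU/set0]_(f <- A) CF_cyl n [fset f]%fset :> set (CF_borel S).
  rewrite -bigcup_fset; apply/seteqP.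
  split=> [y /CF_cylE[f fA yf]|y [f fA /CF_cyl1E yf]].
    by exists f => //; apply/CF_cyl1E.
  by apply/CF_cylE; exists f.
rewrite measure_fbigsetU.
- rewrite weightE -sumEFin big_seq [RHS]big_seq; apply: eq_bigr => f fA.
  by apply: refined_measure_cyl1; exact: AF.
- by move=> f _; exact: measurable_CF_cyl.
by move=> f f' _ _ [y [/CF_cyl1E yf /CF_cyl1E yf']]; exact: pos_uniq yf yf'.
Qed.

(* At most half of the mass of a cylinder is lost in the bad sets. *)
Lemma refined_weights_gt0 n i : 0 < refined_weights n i ord0.
Proof.
have [lam0 _] := Hlam; have [_ muE] := Hmu; pose e : Gl G k := (1%g, i).
have eF : e \in CF_F S n := CF_F_one S n i.
pose a := lam (l n) i ord0; have a0 : 0 < a := lam0 _ _.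
have mB p : measurable (bad_set (n + p)%N) by exact: measurable_CF_cyl.
pose Z : set (CF_borel S) := CF_cyl n [fset e]%fset.
have mZ : measurable (embed @` Z).
  by apply: measurable_image_embed; exact: measurable_CF_cyl.
have mU : measurable (\bigcup_p bad_set (n + p)%N) by exact: bigcupT_measurable.
have sub : CF_cyl (l n) [fset e]%fset `<=` embed @` Z `|` \bigcup_p bad_set (n + p)%N.
  move=> x /CF_cyl1E xe.
  have [H|/existsNP[m /not_implyP[nm ng]]] :=
      pselect (forall m, (n <= m)%N -> @good_set G k T g_ l m x).
    by left; rewrite embed_cyl ?fsub1set//; split; [apply/CF_cyl1E|exact: H].
  right; exists (m - n)%N => //; rewrite subnKC//.
  by have [h xh _] := pos_fstars (lle nm) xe; exact: bad_setP xh ng.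
have bad_le : (mu (\bigcup_p bad_set (n + p)%N) <= (a / 2)%:E)%E.
  apply: le_trans (measure_sigma_subadditive mu mB mU (@subset_refl _ _)) _.
  apply: le_trans (epsilon_trick0 xpredT (divr_ge0 (ltW a0) (ler0n R 2))).
  apply: lee_nneseries => [p _ _|p _]; first exact: measure_ge0.
  apply: le_trans (mu_bad_set (n + p)) _.
  (* The tolerance at [l (n + p)] takes the weight [a] of level [l n] into account, so it is at most
     a / 2^(l (n + p) + 2). As l (n + p) >= p, this is at most (a / 2) / 2^(p + 1), and these bounds
     sum to a / 2. *)
  rewrite lee_fin; apply: (le_trans (@tolerance_le _ _ lam (l n) (l (n + p)) i _)).
    by apply: leqW; rewrite lle// leq_addr.
  rewrite mulrC -mulrA ler_pM2l// -invfM natrX -exprS.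
  rewrite lef_pV2 ?posrE ?exprn_gt0// ler_eXn2l ?ltr1n// !ltnS.
  by apply: leq_trans (lge _); exact: leq_addl.
have : (a%:E <= refined_measure Z + (a / 2)%:E)%E.
  have -> : a%:E = mu (CF_cyl (l n) [fset e]%fset).
    by rewrite muE ?fsub1set// weight1.
  apply: (@le_trans _ _ (mu (embed @` Z `|` \bigcup_p bad_set (n + p)%N))).
    by apply: le_measure; rewrite ?inE//; [exact: measurable_CF_cyl|exact: measurableU].
  apply: le_trans (measureU2 _ _ _) _ => //.
  have -> : refined_measure Z = mu (embed @` Z).
    by apply: refined_measureE; exact: measurable_CF_cyl.
  exact: leeD (lexx _) bad_le.
rewrite (refined_measure_cyl1 eF) -EFinD lee_fin /=; lra.
Qed.

(** The cylinder at [(1, i)], rewritten one stage later, is sorted by last index. Since c ->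
    [star (1, i) c] is injective on blocks starting at [i], the pieces are counted by row i of the
    matrix. *)
Lemma refined_weights_CF : CF_weights S refined_weights.
Proof.
split=> [n i|n]; first exact: refined_weights_gt0.
apply/colP => i; rewrite [RHS]mxE; apply: EFin_inj.
have eF : (1%g, i) \in CF_F S n := CF_F_one S n i.
rewrite -(refined_measure_cyl1 eF) (CF_cyl_fstars (leqnSn n)) ?fsub1set//.
rewrite refined_measure_cyl; last first.
  by apply: fstars_sub; rewrite ?fsub1set.
congr EFin; apply: eq_bigr => j _; congr (_ * _); rewrite mxE; congr (_%:R).
rewrite fstarsS// fstars_id.
have -> : slice (fstar [fset (1%g, i)]%fset (CF_C S n.+1)) j =
    [fset star (1%g, i) c | c in slice2 (CF_C S n.+1) i j]%fset.
  apply/fsetP => h; apply/idP/imfsetP => [|[c /= + ->]].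
    rewrite in_slice => /andP[/in_fstarP[f [c [/fset1P -> cC fc ->]]] hj].
    by exists c => //=; rewrite in_slice2 cC hj -(eqP fc) eqxx.
  rewrite in_slice2 in_slice => /and3P[cC ci ->]; rewrite andbT.
  apply/in_fstarP; exists (1%g, i), c; rewrite inE; split=> //.
  by rewrite /composable eq_sym.
rewrite card_in_imfset//= => c c'; rewrite !in_slice2 => /and3P[_ /eqP ci _].
move=> /and3P[_ /eqP c'i _]; rewrite /star /= !mul1g.
by case: c c' ci c'i => [[a b] d] [[a' b'] d'] /= -> -> [-> ->].
Qed.

(** The towers are pulled back by [embed]. Preimages commute with the actions by [act_image_embed]
    and preserve mass, so disjointness and every approximation error carry over unchanged. *)
Lemma refined_measure_rank (K : nat) (e : int -> G) : (forall g, exists j, g_ j = g) ->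
  rank_at_most K mu (fun z => @CF_action G k T (e z)) ->
  rank_at_most K refined_measure (fun z => @CF_action G k S (e z)).
Proof.
move=> g_surj [B [h [mB tB cB]]].
have actE g (D : set (CF_borel T)) : act_image (@CF_action G k S) g (embed @^-1` D) =
  embed @^-1` act_image (@CF_action G k T) g D by exact: act_image_embed.
exists (fun n j => embed @^-1` B n j), h; split.
- move=> n j; have [mBn Bfin] := mB n j; split; first exact: measurable_preimage_embed.
  by rewrite -(refined_measure_preimage mBn) in Bfin.
- move=> n p q hp hq [y [yp yq]]; apply: (tB n p q hp hq); exists (embed y); split.
    by have := actE (e p.2%:Z) (B n p.1) => /seteqP[/(_ y yp)].
  by have := actE (e q.2%:Z) (B n q.1) => /seteqP[/(_ y yq)].
move=> D mD Dfin; pose D' := embed_inv @^-1` D.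
have mD' : measurable D'.
  exact: measurable_preimage_embed_inv.
have DE : D = embed @^-1` D' by apply/seteqP; split=> y; rewrite /D' /= embed_invK.
have D'fin : (mu D' < +oo)%E := Dfin.
pose U n (E : 'I_K -> set nat) := \bigcup_(j in [set: 'I_K]) \bigcup_(g in E j)
  act_image (@CF_action G k T) (e g%:Z) (B n j).
pose V n (E : 'I_K -> set nat) := \bigcup_(j in [set: 'I_K]) \bigcup_(g in E j)
  act_image (@CF_action G k S) (e g%:Z) (embed @^-1` B n j).
have mU n E : measurable (U n E).
  apply: fin_bigcup_measurable; first exact: finite_finset.
  move=> j _; apply: bigcup_measurable => g _.
  by apply: measurable_act_image; have [] := mB n j.
have VE n E : V n E = embed @^-1` U n E.
  rewrite /V /U preimage_bigcup; apply: eq_bigcupr => j _.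
  by rewrite preimage_bigcup; apply: eq_bigcupr => g _; exact: actE.
have key n E : mu (D' `+` U n E) = refined_measure (D `+` V n E).
  have mDU : measurable (D' `+` U n E).
    rewrite setYE; apply: measurableD.
      exact: (measurableU _ _ mD' (mU n E)).
    exact: (measurableI _ _ mD' (mU n E)).
  by rewrite -(refined_measure_preimage mDU) VE [in RHS]DE.
apply: cvg_trans (cB D' mD' D'fin); apply: near_eq_cvg; apply: nearW => n.
exact: (congr1 (@ereal_inf R) (@eq_imagel _ _ _ (fun E => mu (D' `+` U n E))
  (fun E => refined_measure (D `+` V n E)) (fun E _ => key n E))).
Qed.

End RefinedMeasure.

Theorem theorem4p10 (R : realType) (G : groupType)
    (Gcountable : countable [set: G]) (Ginfinite : infinite_set [set: G])
    (k : nat) (T : CFseq G k)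
    (lam : nat -> 'cV[R]_k.+1) (mu : {measure set (CF_borel T) -> \bar R})
    (Hlam : CF_weights T lam) (Hmu : CF_measure lam mu)
    (Hlim : forall (g : G) (n : nat), (0 < n)%N ->
       weight (lam m) (fstars (CF_C T) (ftranslate g (CF_F T n)) n m `&` CF_F T m)%fset
         @[m --> \oo] --> weight (lam n) (CF_F T n)) :
  exists (S : CFseq G k) (lam' : nat -> 'cV[R]_k.+1)
         (nu : {measure set (CF_borel S) -> \bar R}),
    CF_weights S lam' /\
    CF_measure lam' nu /\
    (forall (g : G) (n : nat), (0 < n)%N -> exists2 m, (n < m)%N &
       (fstars (CF_C S) (ftranslate g (CF_F S n)) n m `<=` CF_F S m)%fset) /\
    isomorphic mu (@CF_action G k T) nu (@CF_action G k S) /\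
    (exists2 l : nat -> nat, {homo l : i j / (i < j)%N} &
       forall n, CF_F S n = CF_F T (l n)) /\
    (forall e : int -> G, bijective e ->
       (forall a b : int, e (a + b) = (e a * e b)%g) ->
       rank_at_most k.+1 mu (fun z : int => @CF_action G k T (e z)) ->
       rank_at_most k.+1 nu (fun z : int => @CF_action G k S (e z))).
Proof.
(* [g_] is a left inverse of an injection of G into the natural numbers, with default value 1
   outside its range. *)
have [g_ g_surj] : exists g_ : nat -> G, forall g, exists j, g_ j = g.
  have /countable_injP[r r_inj] := Gcountable.
  have /choice[g_ g_P] n : exists g, forall g', r g' = n -> g' = g.
    have [[g gn]|H] := pselect (exists g, r g = n).
      by exists g => g' g'n; apply: r_inj; rewrite ?inE// g'n.
    by exists 1%g => g' g'n; case: H; exists g'.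
  by exists g_ => g; exists (r g); apply/esym/g_P.
have [l [l0 lmono bad_small]] := select_levels Hlam Hmu Hlim g_.
have [lam0 _] := Hlam.
have good_gt1 n (i : 'I_k.+1) : exists c1 c2,
    [/\ c1 \in good_blocks T g_ (l n) (l n.+1),
        c2 \in good_blocks T g_ (l n) (l n.+1), c1 != c2, c1.1.1 = i & c2.1.1 = i].
  apply: (many_good_blocks Hlam Hmu); first exact: lmono.
  move=> j; apply: (lt_le_trans (bad_small n)).
  (* Level l n + 1, where the two distinct first blocks are compared, is the last one that the
     tolerance takes into account. *)
  apply: le_trans (tolerance_le lam j (leqnn _)) _.
  by rewrite ger_pMl// invf_le1 ?exprn_gt0// exprn_ege1// ler1n.
exists (refined l0 lmono good_gt1), (refined_weights mu l0 lmono good_gt1),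
  (@refined_measure R G k T mu g_ l l0 lmono good_gt1).
split; first exact: (refined_weights_CF Hlam Hmu).
split; first by split; [exact: (refined_measure_radon Hmu)
                       |move=> n A; exact: (refined_measure_cyl Hmu)].
split; first by move=> g n; exact: refined_exhaustive.
split; first exact: (refined_measure_isomorphic Hmu).
split; first by exists l.
by move=> e _ _; exact: (refined_measure_rank Hmu).
Qed.
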